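(* Let $S$ be a finite nonempty set of primes, $l=\#S$, $d,m\ge1$, $n=d+m$. For each $\nu\in S$ let $\mathcal{U}_\nu\subseteq\mathbb{Z}_\nu^d$ be open, $\mathbf{f}_\nu:\mathcal{U}_\nu\to\mathbb{Z}_\nu^m$ a $C^2$ map, $\mathbf{F}_\nu(\mathbf{x})=(\mathbf{x},\mathbf{f}_\nu(\mathbf{x}))$, $\mathcal{M}_\nu=\mathbf{F}_\nu(\mathcal{U}_\nu)$; let $\mathcal{U}=\prod_{\nu\in S}\mathcal{U}_\nu$ and $\mathbf{F}((\mathbf{x}_\nu)_\nu)=(\mathbf{F}_\nu(\mathbf{x}_\nu))_\nu\in\mathbb{Z}_S^n$. Let $\boldsymbol{\tau}=(\tau_{i,\nu})_{1\le i\le n,\nu\in S}\in\mathbb{R}_+^{nl}$ satisfy (a) $\sum_{i=1}^n\sum_{\nu\in S}\tau_{i,\nu}=n+1$; (b) $\min_{1\le i\le d}\tau_{i,\nu}\ge\max_{1\le j\le m}\tau_{d+j,\nu}$ for all $\nu\in S$; (c) $\frac{1}{n+1}\sum_{i=1}^n\tau_{i,\nu}<\tau_{j,\nu}$ for all $1\le j\le n$, $\nu\in S$. For $\nu\in S$ define $\boldsymbol{\tau}^\nu=(\tau^\nu_{i,\sigma})_{1\le i\le n,\ \sigma\in S\setminus\{\nu\}}$ by $\tau^\nu_{i,\sigma}=\tau_{i,\sigma}\big/\big(1-\frac{1}{n+1}\sum_{k=1}^n\tau_{k,\nu}\big)$. Suppose that for every $\nu\in S$ with $\min_{1\le i\le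 n}\tau_{i,\nu}\le1$, $$\omega_{\boldsymbol{\tau}^\nu}\Big(\prod_{\sigma\in S\setminus\{\nu\}}\mathcal{M}_\sigma\Big)<\frac{1-\frac{1}{n+1}\sum_{i=1}^n\tau_{i,\nu}}{1-\min_{1\le i\le n}\tau_{i,\nu}}.$$ Then $\mu_{S,d}\big(\mathbf{F}^{-1}(\mathbf{Bad}^{(S)}_n(\boldsymbol{\tau}))\big)=0$.
   Context: For a prime $\nu$, $\mathbb{Q}_\nu$ is the field of $\nu$-adic numbers with absolute value $|\cdot|_\nu$ ($|\nu|_\nu=\nu^{-1}$), $\mathbb{Z}_\nu=\{x:|x|_\nu\le1\}$; $C^2$ is in the sense of ultrametric calculus. For a finite set $T$ of primes, $\mathbb{Q}_T=\prod_{\nu\in T}\mathbb{Q}_\nu$, $\mathbb{Z}_T=\prod_{\nu\in T}\mathbb{Z}_\nu$, and $\mu_{T,k}$ is the Haar measure on $\mathbb{Q}_T^k$ normalized so $\mu_{T,k}(\mathbb{Z}_T^k)=1$. Points of $\mathbb{Q}_T^n$ are written $\mathbf{y}=(y_{i,\nu})_{1\le i\le n,\nu\in T}$. For $\tilde{\mathbf{b}}=(b_0,\dots,b_n)\in\mathbb{Z}^{n+1}$, $\|\tilde{\mathbf{b}}\|_\infty=\max_i|b_i|$. Bad set: for $c>0$, $W(c;\boldsymbol{\tau})$ is the set of $\mathbf{y}\in\mathbb{Z}_S^n$ such that for infinitely many $\tilde{\mathbf{b}}\in\mathbb{Z}^{n+1}$, $|b_0y_{i,\nu}-b_i|_\nu<c\|\tilde{\mathbf{b}}\|_\infty^{-\tau_{i,\nu}}$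 for all $1\le i\le n$, $\nu\in S$; $\mathbf{Bad}^{(S)}_n(\boldsymbol{\tau})=W(1;\boldsymbol{\tau})\setminus\bigcap_{k\in\mathbb{N}}W(\tfrac1k;\boldsymbol{\tau})$. Diophantine exponents: for weights $\boldsymbol{\kappa}=(\kappa_{i,\nu})_{1\le i\le n,\nu\in T}$ with positive entries summing to $n+1$ and $\mathbf{y}\in\mathbb{Q}_T^n$, $\omega_{\boldsymbol{\kappa}}(\mathbf{y})=\sup\{\omega:\ \max_{i,\nu}|b_0y_{i,\nu}+b_i|_\nu^{1/\kappa_{i,\nu}}\le\|\tilde{\mathbf{b}}\|_\infty^{-\omega}\text{ for infinitely many }\tilde{\mathbf{b}}\in\mathbb{Z}^{n+1}\}$. For the manifold $\prod_{\nu\in T}\mathcal{M}_\nu$ parametrized by $\mathbf{F}_T=(\mathbf{F}_\nu)_{\nu\in T}$ on $\prod_{\nu\in T}\mathcal{U}_\nu$, $\omega_{\boldsymbol{\kappa}}(\prod_{\nu\in T}\mathcal{M}_\nu)=\inf\{\omega:\ \omega_{\boldsymbol{\kappa}}(\mathbf{F}_T(\mathbf{x}))\le\omega\text{ for }\mu_{T,d}\text{-a.e. }\mathbf{x}\in\prod_{\nu\in T}\mathcal{U}_\nu\}$. *)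

(* Defs.v *)
From HB Require Import structures.
From mathcomp Require Import all_boot all_order all_algebra finmap.
From mathcomp Require Import all_classical all_reals all_analysis.

Set Implicit Arguments.
Unset Strict Implicit.
Unset Printing Implicit Defensive.

Import Order.TTheory GRing.Theory Num.Theory.

Local Open Scope classical_set_scope.
Local Open Scope ring_scope.

Notation prime_nat := {p : nat | prime p}.

Section PadicInt.
Variable p : prime_nat.

Local Notation q k := ((val p ^ k)%N%:Z).

(* The inverse limit of the Z/p^k: [pint_res x k] in [0, p^k) is the residue of
   x modulo p^k. *)
Record padic_int := PadicInt {
  pint_res :> nat -> int;
  pint_resP : forall k, pint_res k = (pint_res k.+1 %% q k)%Z }.

HB.instance Definition _ := gen_eqMixin padic_int.
HB.instance Definition _ := gen_choiceMixin padic_int.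

Lemma pint_p_gt1 : (1 < val p)%N.
Proof. by apply: prime_gt1; exact: (valP p). Qed.

Lemma pint_q_gt0 k : 0 < q k.
Proof. by rewrite ltz_nat expn_gt0 (ltn_trans _ pint_p_gt1). Qed.

Lemma pint_ext (x y : padic_int) : x =1 y -> x = y.
Proof.
case: x y => [x Px] [y Py] /= /funext exy; subst y.
by congr PadicInt; exact: Prop_irrelevance.
Qed.

Lemma pint_mod (x : padic_int) k : (x k %% q k)%Z = x k.
Proof. by rewrite [in LHS]pint_resP modz_mod -pint_resP. Qed.

Lemma pint_q_dvd k j : (k <= j)%N -> (q k %| q j)%Z.
Proof. by move=> kj; rewrite dvdzE !absz_nat dvdn_exp2l. Qed.

Lemma pint_modz_q (a : int) k j : (k <= j)%N -> ((a %% q j)%Z %% q k)%Z = (a %% q k)%Z.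
Proof.
by move=> kj; apply/eqP; rewrite eqz_mod_dvd [(a %% q j)%Z]/modz addrAC subrr
  add0r rpredN dvdz_mull// pint_q_dvd.
Qed.

Lemma pint_resD (x : padic_int) k j : x k = (x (j + k)%N %% q k)%Z.
Proof.
elim: j => [|j IH]; first by rewrite add0n pint_mod.
by rewrite IH pint_resP pint_modz_q// leq_addl.
Qed.

Lemma pint_mkP (s : nat -> int) :
  (forall k, (s k = s k.+1 %[mod q k])%Z) ->
  forall k, (s k %% q k)%Z = ((s k.+1 %% q k.+1)%Z %% q k)%Z.
Proof. by move=> sP k; rewrite pint_modz_q// sP. Qed.

Definition pint_mk s (sP : forall k, (s k = s k.+1 %[mod q k])%Z) : padic_int :=
  PadicInt (pint_mkP sP).

Lemma pint_natP n k : (n = n %[mod q k])%Z. Proof. by []. Qed.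
Lemma pint_addP (x y : padic_int) k :
  (x k + y k = x k.+1 + y k.+1 %[mod q k])%Z.
Proof. by rewrite (pint_resP x) (pint_resP y) modzDm. Qed.
Lemma pint_oppP (x : padic_int) k : (- x k = - x k.+1 %[mod q k])%Z.
Proof. by rewrite (pint_resP x) modzNm. Qed.
Lemma pint_mulP (x y : padic_int) k :
  (x k * y k = x k.+1 * y k.+1 %[mod q k])%Z.
Proof. by rewrite (pint_resP x) (pint_resP y) modzMm. Qed.

Definition pint0 := pint_mk (pint_natP 0).
Definition pint1 := pint_mk (pint_natP 1).
Definition pint_add x y := pint_mk (pint_addP x y).
Definition pint_opp x := pint_mk (pint_oppP x).
Definition pint_mul x y := pint_mk (pint_mulP x y).

Lemma pint_addA : associative pint_add.
Proof. by move=> x y z; apply: pint_ext => k /=; rewrite modzDmr modzDml addrA. Qed.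
Lemma pint_addC : commutative pint_add.
Proof. by move=> x y; apply: pint_ext => k /=; rewrite addrC. Qed.
Lemma pint_add0 : left_id pint0 pint_add.
Proof. by move=> x; apply: pint_ext => k /=; rewrite modzDml add0r pint_mod. Qed.
Lemma pint_addN : left_inverse pint0 pint_opp pint_add.
Proof. by move=> x; apply: pint_ext => k /=; rewrite modzDml addNr. Qed.
Lemma pint_mulA : associative pint_mul.
Proof. by move=> x y z; apply: pint_ext => k /=; rewrite modzMmr modzMml mulrA. Qed.
Lemma pint_mulC : commutative pint_mul.
Proof. by move=> x y; apply: pint_ext => k /=; rewrite mulrC. Qed.
Lemma pint_mul1 : left_id pint1 pint_mul.
Proof. by move=> x; apply: pint_ext => k /=; rewrite modzMml mul1r pint_mod. Qed.
Lemma pint_mulDl : left_distributive pint_mul pint_add.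
Proof.
by move=> x y z; apply: pint_ext => k /=; rewrite modzDm modzMml mulrDl.
Qed.
Lemma pint_1neq0 : pint1 != pint0.
Proof.
apply/eqP => /(congr1 (fun x : padic_int => x 1%N)) /=.
by rewrite mod0z modz_small// expn1 ltz_nat pint_p_gt1.
Qed.

HB.instance Definition _ := GRing.isZmodule.Build padic_int
  pint_addA pint_addC pint_add0 pint_addN.
HB.instance Definition _ := GRing.Zmodule_isComNzRing.Build padic_int
  pint_mulA pint_mulC pint_mul1 pint_mulDl pint_1neq0.

HB.instance Definition _ := isPointed.Build padic_int 0.

Lemma pint_res0 k : (0 : padic_int) k = 0.
Proof. by rewrite /= mod0z. Qed.

Lemma pint_neq0P (x : padic_int) : x != 0 -> exists k, x k != 0.
Proof.
move=> /eqP x0; apply: contrapT => nex; apply: x0; apply: pint_ext => k.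
by rewrite pint_res0; apply: contrapT => /eqP xk; apply: nex; exists k.
Qed.

(* The p-adic order of a nonzero x: x is divisible by p^k but not by p^(k+1). *)
Definition pint_ord (x : padic_int) : nat :=
  get [set k | x k = 0 /\ x k.+1 <> 0].

Lemma pint_res_eq0 (x : padic_int) k j :
  (k <= j)%N -> x j = 0 -> x k = 0.
Proof. by move=> kj xj; rewrite (pint_resD x k (j - k)) subnK// xj mod0z. Qed.

Lemma pint_ordP (x : padic_int) : x != 0 ->
  x (pint_ord x) = 0 /\ x (pint_ord x).+1 <> 0.
Proof.
move=> /pint_neq0P exk.
suff: [set k | x k = 0 /\ x k.+1 <> 0] (pint_ord x) by [].
apply: getPex; case: (ex_minnP exk) => -[|k] xk mink.
  by move: xk; rewrite pint_resP /= expn0 modz1.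
exists k; split; last exact/eqP.
by apply/eqP/negP => /negP /mink; rewrite ltnn.
Qed.

Lemma pint_ordE (x : padic_int) k : x k = 0 -> x k.+1 <> 0 -> pint_ord x = k.
Proof.
move=> xk xk1.
have x0 : x != 0 by apply/eqP => x0; apply: xk1; rewrite x0 pint_res0.
have [yk yk1] := pint_ordP x0.
apply/eqP; rewrite eqn_leq; apply/andP; split; rewrite leqNgt; apply/negP => h.
  exact/xk1/(pint_res_eq0 h yk).
exact/yk1/(pint_res_eq0 h xk).
Qed.

Lemma pint_dvd (x : padic_int) k j : (k <= j)%N -> (q k %| x j)%Z = (x k == 0).
Proof.
by move=> kj; rewrite (pint_resD x k (j - k)) subnK//; apply/dvdz_mod0P/eqP.
Qed.

Lemma pint_mulE (x y : padic_int) k : (x * y) k = ((x k * y k)%R %% q k)%Z.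
Proof. by []. Qed.

Lemma pint_addE (x y : padic_int) k : (x + y) k = ((x k + y k)%R %% q k)%Z.
Proof. by []. Qed.

Lemma pint_ordM (x y : padic_int) : x != 0 -> y != 0 ->
  x * y != 0 /\ pint_ord (x * y) = (pint_ord x + pint_ord y)%N.
Proof.
move=> x0 y0; have [xa xa1] := pint_ordP x0; have [yb yb1] := pint_ordP y0.
set a := pint_ord x in xa xa1 *; set b := pint_ord y in yb yb1 *.
have le1 : (a <= (a + b).+1)%N by rewrite leqW// leq_addr.
have le2 : (a.+1 <= (a + b).+1)%N by rewrite ltnS leq_addr.
have le3 : (b <= (a + b).+1)%N by rewrite leqW// leq_addl.
have le4 : (b.+1 <= (a + b).+1)%N by rewrite ltnS leq_addl.
have xy1 : (x * y) (a + b).+1 <> 0.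
  rewrite pint_mulE => /dvdz_mod0P.
  have := pint_dvd x le1; have := pint_dvd x le2.
  have := pint_dvd y le3; have := pint_dvd y le4.
  rewrite xa yb eqxx; move/eqP/negPf : xa1 => ->; move/eqP/negPf: yb1 => ->.
  move: (x _) (y _) => u v; rewrite !dvdzE !absz_nat abszM.
  move=> hv1 hv hu1 hu.
  have u0 : (0 < `|u|)%N by rewrite lt0n; apply: contraFneq hu1 => ->; rewrite dvdn0.
  have v0 : (0 < `|v|)%N by rewrite lt0n; apply: contraFneq hv1 => ->; rewrite dvdn0.
  have pp : prime (val p) by exact: (valP p).
  move: hu1 hv1; rewrite !pfactor_dvdn// ?muln_gt0 ?u0 ?v0//.
  move=> /negbT; rewrite -leqNgt => hu1 /negbT; rewrite -leqNgt => hv1.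
  by rewrite lognM// => /leq_trans/(_ (leq_add hu1 hv1)); rewrite ltnn.
have xyab : (x * y) (a + b)%N = 0.
  rewrite pint_mulE; apply/dvdz_mod0P.
  have : (q a %| x (a + b)%N)%Z by rewrite pint_dvd ?leq_addr// xa.
  have : (q b %| y (a + b)%N)%Z by rewrite pint_dvd ?leq_addl// yb.
  by move=> hb ha; rewrite expnD PoszM dvdz_mul.
split; last exact: pint_ordE.
by apply/eqP => xy0; apply: xy1; rewrite xy0 pint_res0.
Qed.

Lemma pint_ordD (x y : padic_int) k : x k = 0 -> y k = 0 -> (x + y) k = 0.
Proof. by move=> xk yk; rewrite pint_addE xk yk addr0 mod0z. Qed.

Definition pint_unit : {pred padic_int} := [pred x | `[< exists y, y * x = 1 >]].
Definition pint_inv (x : padic_int) : padic_int :=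
  if x \in pint_unit then get [set y | y * x = 1] else x.

Lemma pint_mulVx : {in pint_unit, left_inverse 1 pint_inv *%R}.
Proof.
move=> x xu; rewrite /pint_inv xu.
have /asboolP [y yx] := xu.
by apply: (@getPex _ [set y | y * x = 1]); exists y.
Qed.

Lemma pint_unitPl (x y : padic_int) : y * x = 1 -> x \in pint_unit.
Proof. by move=> yx; apply/asboolP; exists y. Qed.

Lemma pint_inv_out : {in [predC pint_unit], pint_inv =1 id}.
Proof.
by move=> x xu; rewrite /pint_inv; case: ifPn => // xu'; move: xu; rewrite inE /= xu'.
Qed.

HB.instance Definition _ := GRing.ComNzRing_hasMulInverse.Build padic_int
  pint_mulVx pint_unitPl pint_inv_out.

Lemma pint_idomain (x y : padic_int) : x * y = 0 -> (x == 0) || (y == 0).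
Proof.
move=> xy; apply: contrapT => /negP; rewrite negb_or => /andP[x0 y0].
by have [/eqP] := pint_ordM x0 y0.
Qed.

HB.instance Definition _ :=
  GRing.ComUnitRing_isIntegral.Build padic_int pint_idomain.

End PadicInt.

Section Padic.
Variable p : prime_nat.

Definition padic := {fraction (padic_int p)}.

HB.instance Definition _ := GRing.Field.on padic.
HB.instance Definition _ := isPointed.Build padic 0.

Section Abs.
Variable F : numFieldType.

Definition pint_abs (x : padic_int p) : F :=
  if x == 0 then 0 else (val p)%:R ^- pint_ord x.

(* |a / b| = |a| / |b|, so that |p| = 1/p. *)
Definition padic_abs (x : padic) : F :=
  pint_abs (repr x).1 / pint_abs (repr x).2.

Let pF_gt0 : 0 < (val p)%:R :> F.
Proof. by rewrite ltr0n (ltn_trans _ (pint_p_gt1 p)). Qed.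

Lemma pint_abs_ge0 x : 0 <= pint_abs x.
Proof. by rewrite /pint_abs; case: ifP => // _; rewrite invr_ge0 exprn_ge0// ltW. Qed.

Lemma pint_abs_eq0 x : (pint_abs x == 0) = (x == 0).
Proof.
rewrite /pint_abs; case: (eqVneq x 0) => _; first exact: eqxx.
by rewrite invr_eq0 expf_eq0 (gt_eqF pF_gt0) andbF.
Qed.

Lemma pint_absM (x y : padic_int p) : pint_abs (x * y) = pint_abs x * pint_abs y.
Proof.
rewrite /pint_abs; have [->|x0] := eqVneq x 0; first by rewrite !mul0r eqxx.
have [->|y0] := eqVneq y 0; first by rewrite !mulr0 eqxx.
have [/negPf -> ->] := pint_ordM x0 y0.
by rewrite exprD invfM.
Qed.

Lemma pint_absN (x : padic_int p) : pint_abs (- x) = pint_abs x.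
Proof.
rewrite /pint_abs oppr_eq0; case: ifPn => // x0.
have [xk xk1] := pint_ordP x0.
congr (_ ^- _); apply: pint_ordE; first by rewrite /= xk oppr0 mod0z.
rewrite /= => /dvdz_mod0P; rewrite rpredN => /dvdz_mod0P.
by rewrite pint_mod.
Qed.

Lemma pint_absD (x y : padic_int p) :
  pint_abs (x + y) <= pint_abs x \/ pint_abs (x + y) <= pint_abs y.
Proof.
have [->|x0] := eqVneq x 0; first by rewrite add0r; right.
have [->|y0] := eqVneq y 0; first by rewrite addr0; left.
have [xy0|xy0] := eqVneq (x + y) 0.
  by left; rewrite xy0 {1}/pint_abs eqxx pint_abs_ge0.
rewrite /pint_abs (negPf x0) (negPf y0) (negPf xy0).
have p1 : 1 <= (val p)%:R :> F by rewrite ler1n ltnW// pint_p_gt1.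
suff : (minn (pint_ord x) (pint_ord y) <= pint_ord (x + y)%R)%N.
  by rewrite geq_min => /orP[]h; [left|right];
    rewrite lef_pV2 ?posrE ?exprn_gt0//; apply: ler_weXn2l.
have [xk _] := pint_ordP x0; have [yk _] := pint_ordP y0.
have [_ xyk1] := pint_ordP xy0; rewrite leqNgt; apply/negP => h; apply: xyk1.
by apply: pint_ordD; [apply: pint_res_eq0 xk|apply: pint_res_eq0 yk];
  apply: leq_trans h _; rewrite ?geq_minl ?geq_minr.
Qed.

Local Notation "x %:F" := (@FracField.tofrac (padic_int p) x).

Lemma padic_numden (x : padic) : x = ((repr x).1)%:F / ((repr x).2)%:F.
Proof.
have d0 : ((repr x).2)%:F != 0 by rewrite tofrac_eq0 denom_ratioP.
apply/(mulIf d0); rewrite divfK//; set r := repr x.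
rewrite -[x in LHS]reprK -/r; unlock FracField.tofrac.
rewrite -[LHS]FracField.pi_mul; apply/eqmodP.
by rewrite /= FracField.equivfE /FracField.mulf !numden_Ratio
  ?mulf_neq0 ?oner_eq0 ?denom_ratioP// !mulr1 mulrC.
Qed.

Lemma padic_absE (a b : padic_int p) : b != 0 ->
  padic_abs (a%:F / b%:F) = pint_abs a / pint_abs b.
Proof.
move=> b0; set x := a%:F / b%:F; rewrite /padic_abs.
have := padic_numden x; move: (denom_ratioP (repr x)).
move: ((repr x).1) ((repr x).2) => n d d0; rewrite /x => /eqP.
rewrite eqr_div ?tofrac_eq0// -!tofracM tofrac_eq => /eqP/(congr1 pint_abs).
rewrite !pint_absM => e; apply/eqP; rewrite eqr_div ?pint_abs_eq0//.
by rewrite e mulrC.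
Qed.

Lemma padic_abs_ge0 x : 0 <= padic_abs x.
Proof. by rewrite divr_ge0// pint_abs_ge0. Qed.

Lemma padic_abs_eq0 x : (padic_abs x == 0) = (x == 0).
Proof.
rewrite [in RHS](padic_numden x) /padic_abs !mulf_eq0 !invr_eq0.
by rewrite !pint_abs_eq0 !tofrac_eq0.
Qed.

Lemma padic_absM (x y : padic) : padic_abs (x * y) = padic_abs x * padic_abs y.
Proof.
rewrite [in LHS](padic_numden x) [in LHS](padic_numden y) mulf_div -!tofracM.
by rewrite padic_absE ?mulf_neq0 ?denom_ratioP// !pint_absM -mulf_div.
Qed.

Lemma padic_absN (x : padic) : padic_abs (- x) = padic_abs x.
Proof.
rewrite [in LHS](padic_numden x) -mulNr -tofracN padic_absE ?denom_ratioP//.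
by rewrite pint_absN.
Qed.

Lemma padic_absD (x y : padic) : padic_abs (x + y) <= Num.max (padic_abs x) (padic_abs y).
Proof.
have n0 (z : padic) : (repr z).2 != 0 := denom_ratioP (repr z).
have q0 (z : padic) : pint_abs (repr z).2 != 0 by rewrite pint_abs_eq0.
rewrite [in leLHS](padic_numden x) [in leLHS](padic_numden y).
rewrite addf_div ?tofrac_eq0// -!tofracM -tofracD padic_absE ?mulf_neq0//.
rewrite /padic_abs.
move: (n0 x) (n0 y) (q0 x) (q0 y).
move: ((repr x).1) ((repr x).2) ((repr y).1) ((repr y).2).
move=> a b c d b0 d0 qb qd.
have cmp : (pint_abs a / pint_abs b >=< pint_abs c / pint_abs d)%O.
  by rewrite real_comparable// ger0_real// divr_ge0 ?pint_abs_ge0.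
rewrite comparable_le_max//.
have g : 0 < pint_abs (b * d) by rewrite lt_def pint_abs_eq0 mulf_neq0//= pint_abs_ge0.
have [h|h] := pint_absD (a * d) (c * b); apply/orP; [left|right].
  rewrite (le_trans (ler_wpM2r _ h)) ?invr_ge0 ?(ltW g)//.
  by rewrite !pint_absM -mulf_div divff// mulr1.
rewrite (le_trans (ler_wpM2r _ h)) ?invr_ge0 ?(ltW g)//.
by rewrite !pint_absM [pint_abs c * _]mulrC -mulf_div divff// mul1r.
Qed.

End Abs.

Let mdist (x y : padic) : rat := padic_abs rat (x - y).

Let mdistxx x : mdist x x = 0.
Proof. by apply/eqP; rewrite padic_abs_eq0 subrr. Qed.

Let mdist_positivity x y : mdist x y = 0 -> x = y.
Proof. by move=> /eqP; rewrite padic_abs_eq0 subr_eq0 => /eqP. Qed.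

Let mdist_sym x y : mdist x y = mdist y x.
Proof. by rewrite /mdist -padic_absN opprB. Qed.

Let mdist_triangle y x z : mdist x z <= mdist x y + mdist y z.
Proof.
rewrite /mdist -(subrKA y); apply: le_trans (padic_absD _ _ _) _.
by rewrite ge_max lerDl lerDr !padic_abs_ge0.
Qed.

HB.instance Definition _ := isMetric.Build rat padic
  mdistxx mdist_positivity mdist_sym mdist_triangle.

End Padic.

Arguments padic_abs {p} F x.

Section UltrametricCk.
Variables (p : prime_nat) (m : nat).

Definition set_coord N (x : 'rV[padic p]_N) (i : 'I_N) (t : padic p) :
  'rV[padic p]_N := \row_j (if j == i then t else x 0 j).

(* A point (x, t) of the domain of the difference quotient of f with respect to
   the i-th variable: its nodes are x_i and t, the other variables are kept. *)
Definition quot_dom N (U : set 'rV[padic p]_N) (i : 'I_N) :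
  set 'rV[padic p]_(N + 1) :=
  [set w | U (lsubmx w) /\ U (set_coord (lsubmx w) i (rsubmx w 0 0))].

Definition is_quot N (U : set 'rV[padic p]_N) (f : 'rV[padic p]_N -> 'rV[padic p]_m)
    (i : 'I_N) (g : 'rV[padic p]_(N + 1) -> 'rV[padic p]_m) :=
  forall w, quot_dom U i w ->
    let x := lsubmx w in let t := rsubmx w 0 0 in
    t != x 0 i -> g w = (x 0 i - t)^-1 *: (f x - f (set_coord x i t)).

(* Schikhof's definition: f is C^k when all the iterated partial difference
   quotients of f of total order at most k, which are defined where the nodes
   of each variable are distinct, extend to continuous maps across coinciding
   nodes.  On a product U_1 x ... x U_N the orders (i_1, ..., i_N) lead to the
   domain U_1^(i_1 + 1) x ... x U_N^(i_N + 1).  For open U the points with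
   distinct nodes are dense, so the extension g is unique. *)
Fixpoint Ck (k N : nat) (U : set 'rV[padic p]_N)
    (f : 'rV[padic p]_N -> 'rV[padic p]_m) : Prop :=
  {within U, continuous f} /\
  if k is k'.+1 then
    forall i : 'I_N, exists g, is_quot U f i g /\ Ck k' (quot_dom U i) g
  else True.

End UltrametricCk.

(* The coordinate y_{i,nu} of y in Q_T^k is [y nu 0 i]. *)
Definition QT (T : {fset prime_nat}) (k : nat) : Type :=
  prod_topology (fun nu : T => 'rV[padic (val nu)]_k).

HB.instance Definition _ T k := Topological.on (QT T k).
HB.instance Definition _ T k := Pointed.on (QT T k).

Definition borelQT (T : {fset prime_nat}) (k : nat) : Type :=
  g_sigma_algebraType (@open (QT T k)).

HB.instance Definition _ T k := Measurable.on (borelQT T k).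

Definition padic_Zpow (p : prime_nat) (k : nat) : set 'rV[padic p]_k :=
  [set x | forall i, padic_abs rat (x 0 i) <= 1].

Arguments padic_Zpow : clear implicits.

Definition ZT (T : {fset prime_nat}) (k : nat) : set (QT T k) :=
  [set x | forall nu : T, padic_Zpow (val nu) k (x nu)].

Arguments ZT : clear implicits.

Definition translate T k (a x : QT T k) : QT T k := fun nu => x nu + a nu.

(* On the second countable locally compact group Q_T^k these two conditions
   determine mu: it is the Haar measure giving Z_T^k mass 1. *)
Definition is_normalized_haar (R : realType) T k
    (mu : {measure set (borelQT T k) -> \bar R}) : Prop :=
  (forall (A : set (borelQT T k)) (a : QT T k),
     measurable A -> mu (translate a @` A) = mu A) /\
  mu (ZT T k) = 1%E.

Section Approximation.
Variables (R : realType) (T : {fset prime_nat}) (n : nat).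

Definition height (b : 'rV[int]_n.+1) : nat := \max_(i < n.+1) `|b ord0 i|%N.

(* [b 0 (lift ord0 i)] is b_i for i = 1, ..., n. *)
Definition W (c : R) (tau : 'I_n -> prime_nat -> R) : set (QT T n) :=
  [set y | ZT T n y /\
    infinite_set [set b : 'rV[int]_n.+1 | forall (i : 'I_n) (nu : T),
      padic_abs R ((b 0 ord0)%:~R * y nu 0 i - (b 0 (lift ord0 i))%:~R)
        < c * (height b)%:R `^ (- tau i (val nu))]].

Definition Bad (tau : 'I_n -> prime_nat -> R) : set (QT T n) :=
  W 1 tau `\` \bigcap_(k : nat) W (k.+1%:R^-1) tau.

Definition exponent (kappa : 'I_n -> prime_nat -> R) (y : QT T n) : \bar R :=
  ereal_sup [set w%:E | w in [set w : R |
    infinite_set [set b : 'rV[int]_n.+1 |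
      \big[Num.max/0]_(i < n) \big[Num.max/0]_(nu : T)
        (padic_abs R ((b 0 ord0)%:~R * y nu 0 i + (b 0 (lift ord0 i))%:~R)
          `^ (kappa i (val nu))^-1)
      <= (height b)%:R `^ (- w)]]].

End Approximation.

(* Families indexed by S are given on all primes; only their values at the
   elements of the finite set of primes at hand are used. *)
Section Manifold.
Variables (R : realType) (T : {fset prime_nat}) (d m : nat).
Variables (U : forall nu : prime_nat, set 'rV[padic nu]_d).
Variables (f : forall nu : prime_nat, 'rV[padic nu]_d -> 'rV[padic nu]_m).
Arguments f : clear implicits.

Definition prodU : set (QT T d) := [set x | forall nu : T, U (x nu)].

Definition param (x : QT T d) : QT T (d + m) :=
  fun nu => row_mx (x nu) (f (val nu) (x nu)).

Definition manifold_exponent (mu : {measure set (borelQT T d) -> \bar R})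
    (kappa : 'I_(d + m) -> prime_nat -> R) : \bar R :=
  ereal_inf [set w%:E | w in [set w : R |
    {ae mu, forall x, prodU x -> (exponent kappa (param x) <= w%:E)%E}]].

End Manifold.

Section Weights.
Variables (R : realType) (n : nat).

(* The minimum is extended-real so that 1 - min has inverse +oo in \bar R, and
   not 0 as in R, when min = 1. *)
Definition weight_min k (a : 'I_k -> R) : \bar R :=
  (\big[mine/+oo]_(i < k) (a i)%:E)%E.

Definition weight_max k (a : 'I_k -> R) : \bar R :=
  (\big[maxe/-oo]_(i < k) (a i)%:E)%E.

Definition weight_share (tau : 'I_n -> prime_nat -> R) (nu : prime_nat) : R :=
  n.+1%:R^-1 * \sum_(i < n) tau i nu.

(* The weights tau^nu on the primes other than nu. *)
Definition weight_drop (tau : 'I_n -> prime_nat -> R) (nu : prime_nat) :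
    'I_n -> prime_nat -> R :=
  fun i sigma => tau i sigma / (1 - weight_share tau nu).

End Weights.

(* Main.v *)
(** Fix [kap]. For every point x of the manifold and every large H, the pigeonhole
    principle yields an integer vector b of height at most H for which the forms
    b_0 x_i - b_i of the independent coordinates, and the forms of the dependent
    coordinates corrected by the tangent space at x, are all small at level
    [kap^-1 H^(-tau)] up to a constant factor. The hypothesis on the exponents of
    the other primes bounds |b_0|_nu from below for almost every x: if b_0 were
    divisible by too large a power of nu, dividing b by that power would give too
    good approximations at the primes other than nu. Hence the points whose
    independent coordinates are close to b_i / b_0 form a box whose sides tend to 0
    and which contains, near x, a box of comparable measure of points approximated
    by b at the level required for [W kap^-1]; here differentiability and the order
    of the weights control the dependent coordinates. So the set of points not
    approximated beyond height H0 misses a fixed proportion of arbitrarily small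
    boxes around almost each of its points. The boxes have different side lengths,
    so this contradicts positive measure through the strong density theorem, whose
    maximal function is an iterate of one-coordinate maximal functions of weak
    type (1,1). *)

Require Import Defs.
From HB Require Import structures.
From mathcomp Require Import all_boot all_order all_algebra finmap.
From mathcomp Require Import all_classical all_reals all_analysis.
From mathcomp Require Import measurable_realfun.
From mathcomp Require Import ring lra zify.

Set Implicit Arguments.
Unset Strict Implicit.
Unset Printing Implicit Defensive.

Import Order.TTheory GRing.Theory Num.Theory.

Local Open Scope classical_set_scope.
Local Open Scope ring_scope.

(** * Levels of p-adic numbers *)

(** The pigeonhole count misses level [kap^-1 H^-tau] by a constant factor, due to [kap], to
    rounding to prime powers and to the denominators of the tangent matrix. This deficit is charged
    entirely to the independent coordinates: they lose [s] levels, the tangent forms lose none. Only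
    there can it be repaired, since a point can move towards [b_i / b_0] at the price of a fixed
    proportion of its box, while its dependent coordinates merely follow. Condition (b) makes the
    dependent levels the coarser ones, so linear errors and the differentiability remainder fit.
    Condition (c) makes the weights of each coordinate sum to more than 1 over the primes, which
    forces [b_0 != 0]. On the metric side, bounding the levels of boxes by [N] makes maximal sets
    unions of cubes of level [N]; averages along one coordinate are then finite counts of
    translates, and the constants do not depend on [N]. The Haar measures of different sets of
    primes are not given as products of one another, so null sets are pulled back by comparing
    measures on cubes. *)

Section PadicLevel.
Variable p : prime_nat.

(** Stated over [rat], so that it does not depend on the field in which absolute values are compared
    ([lev_abs]). Estimates become statements about natural-number levels, which add under
    products. *)
Definition lev (k : nat) (x : padic p) : bool :=
  padic_abs rat x <= (val p)%:R ^- k.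

Lemma padic_pos (F : numFieldType) : 0 < (val p)%:R :> F.
Proof. by rewrite ltr0n (ltn_trans _ (pint_p_gt1 p)). Qed.

Lemma padic_abs_ratr (F : numFieldType) (x : padic p) :
  padic_abs F x = ratr (padic_abs rat x).
Proof.
have pint_abs_ratr (a : padic_int p) : pint_abs F a = ratr (pint_abs rat a).
  rewrite /pint_abs; case: ifP => _; first by rewrite rmorph0.
  by rewrite fmorphV rmorphXn rmorph_nat.
by rewrite /padic_abs !pint_abs_ratr fmorph_div.
Qed.

Lemma lev_abs (F : numFieldType) k (x : padic p) :
  lev k x = (padic_abs F x <= (val p)%:R ^- k).
Proof.
by rewrite padic_abs_ratr /lev -(ler_rat F) fmorphV rmorphXn rmorph_nat.
Qed.

Lemma lev_le k j (x : padic p) : (k <= j)%N -> lev j x -> lev k x.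
Proof.
move=> kj /le_trans; apply; rewrite lef_pV2 ?posrE ?exprn_gt0 ?padic_pos//.
by apply: ler_weXn2l => //; rewrite ler1n ltnW// pint_p_gt1.
Qed.

Lemma lev_zero k : lev k 0.
Proof.
have /eqP e : padic_abs rat (0 : padic p) == 0 by rewrite padic_abs_eq0.
by rewrite /lev e invr_ge0 exprn_ge0// ltW// padic_pos.
Qed.

Lemma levD k (x y : padic p) : lev k x -> lev k y -> lev k (x + y).
Proof.
by move=> hx hy; apply: (le_trans (padic_absD _ _ _)); rewrite ge_max; apply/andP.
Qed.

Lemma levN k (x : padic p) : lev k (- x) = lev k x.
Proof. by rewrite /lev padic_absN. Qed.

Lemma levB k (x y : padic p) : lev k x -> lev k y -> lev k (x - y).
Proof. by move=> hx hy; apply: levD => //; rewrite levN. Qed.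

Lemma lev_distC k (x y : padic p) : lev k (x - y) = lev k (y - x).
Proof. by rewrite -levN opprB. Qed.

Lemma lev_sum k (I : Type) (r : seq I) (P : pred I) (f : I -> padic p) :
  (forall i, P i -> lev k (f i)) -> lev k (\sum_(i <- r | P i) f i).
Proof. by move=> h; elim/big_ind: _ => //; [exact: lev_zero|move=> x y; exact: levD]. Qed.

Lemma levM j k (x y : padic p) : lev j x -> lev k y -> lev (j + k) (x * y).
Proof.
by move=> hx hy; rewrite /lev padic_absM exprD invfM ler_pM// padic_abs_ge0.
Qed.

Lemma levMr k (x y : padic p) : lev 0 x -> lev k y -> lev k (x * y).
Proof. exact: levM. Qed.

Local Notation "x %:F" := (@FracField.tofrac (padic_int p) x).

Lemma padic_abs_tofrac (a : padic_int p) : padic_abs rat a%:F = pint_abs rat a.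
Proof.
have := @padic_absE p rat a 1 (oner_neq0 _); rewrite tofrac1 divr1 => ->.
rewrite [in X in _ / X]/pint_abs oner_eq0.
suff -> : pint_ord (1 : padic_int p) = 0%N by rewrite expr0 !invr1 mulr1.
apply: pint_ordE => /=; first by rewrite expn0 modz1.
by rewrite modz_small// expn1 ltz_nat pint_p_gt1.
Qed.

Lemma lev_tofrac k (a : padic_int p) : lev k a%:F = (a k == 0).
Proof.
rewrite /lev padic_abs_tofrac /pint_abs; case: eqVneq => [->|a0].
  by rewrite pint_res0 eqxx invr_ge0 exprn_ge0// ltW// padic_pos.
rewrite lef_pV2 ?posrE ?exprn_gt0 ?padic_pos//.
rewrite ler_eXn2l ?ltr1n ?pint_p_gt1//.
have [h h1] := pint_ordP a0; apply/idP/eqP => [|ak].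
  by move=> /pint_res_eq0; apply.
by rewrite leqNgt; apply/negP => /pint_res_eq0/(_ ak).
Qed.

Lemma pint_int_res (z : int) k : (z%:~R : padic_int p) k = (z %% ((val p) ^ k)%N%:Z)%Z.
Proof.
have nat_res n : (n%:R : padic_int p) k = (n%:Z %% ((val p) ^ k)%N%:Z)%Z.
  elim: n => [|n IH]; first by rewrite pint_res0 mod0z.
  by rewrite mulrS pint_addE IH /= modzDm intS.
case: z => n; first by rewrite -pmulrn nat_res.
by rewrite NegzE rmorphN /= -pmulrn nat_res modzNm.
Qed.

Lemma lev_int k (z : int) : lev k (z%:~R : padic p) = (((val p) ^ k)%N%:Z %| z)%Z.
Proof.
by rewrite -(rmorph_int (@FracField.tofrac (padic_int p))) lev_tofrac pint_int_res; apply/eqP/dvdz_mod0P.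
Qed.

Lemma lev_int0 (z : int) : lev 0 (z%:~R : padic p).
Proof. by rewrite lev_int expn0 dvd1z. Qed.

Lemma lev_nat0 (n : nat) : lev 0 (n%:R : padic p).
Proof. exact: (lev_int0 n). Qed.

Lemma lev_nat k (n : nat) : lev k (n%:R : padic p) = ((val p) ^ k %| n)%N.
Proof. by rewrite -[n%:R]/((Posz n)%:~R) lev_int dvdzE. Qed.

Lemma padic_abs_int j (z : int) : lev j (z%:~R : padic p) ->
  ~~ lev j.+1 (z%:~R : padic p) -> padic_abs rat (z%:~R : padic p) = (val p)%:R ^- j.
Proof.
rewrite -(rmorph_int (@FracField.tofrac (padic_int p))) !lev_tofrac.
move=> /eqP h /eqP h1; rewrite padic_abs_tofrac /pint_abs.
rewrite (pint_ordE h h1); case: eqP => // e.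
by case: h1; rewrite e pint_res0.
Qed.

(** An integer of exact order [j] shifts levels by exactly [j], in both directions. This is how one
    divides by [b_0], and with [j = 0] by an integer that is a unit at the given prime. *)
Lemma lev_intM j k (z : int) (x : padic p) : lev j (z%:~R : padic p) ->
  ~~ lev j.+1 (z%:~R : padic p) -> lev (j + k) (z%:~R * x) = lev k x.
Proof.
move=> h h1; rewrite /lev padic_absM (padic_abs_int h h1) exprD invfM.
by rewrite ler_pM2l// invr_gt0 exprn_gt0// padic_pos.
Qed.

Lemma lev_pM j k (x : padic p) : lev (j + k) (((val p) ^ j)%N%:R * x) = lev k x.
Proof.
apply: (@lev_intM j k ((val p ^ j)%N%:Z)); rewrite lev_nat// dvdn_Pexp2l ?pint_p_gt1//.
by rewrite ltnn.
Qed.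

Lemma lev_valuation (z : int) : z != 0 ->
  exists j, [/\ lev j (z%:~R : padic p), ~~ lev j.+1 (z%:~R : padic p) & ((val p) ^ j <= `|z|)%N].
Proof.
move=> z0; have z1 : (0 < `|z|)%N by rewrite absz_gt0.
exists (logn (val p) `|z|); rewrite !lev_int !dvdzE !absz_nat.
have pp : prime (val p) by exact: (valP p).
rewrite !pfactor_dvdn// leqnn ltnn; split=> //.
by rewrite dvdn_leq// pfactor_dvdnn.
Qed.

Lemma lev_bounded (x : padic p) : exists N, lev 0 (((val p) ^ N)%N%:R * x).
Proof.
have /eqP := padic_numden x; set a := (repr x).1; set b := (repr x).2 => /eqP xE.
have b0 : b != 0 by exact: denom_ratioP.
exists (pint_ord b).
have -> : lev 0 (((val p) ^ pint_ord b)%N%:R * x) = (padic_abs rat x <= (val p)%:R ^+ pint_ord b).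
  rewrite /lev padic_absM expr0 invr1.
  set q := (val p ^ pint_ord b)%N.
  have -> : padic_abs rat (q%:R : padic p) = (val p)%:R ^- pint_ord b.
    apply: (@padic_abs_int _ (Posz q)); rewrite lev_nat//.
    by rewrite dvdn_Pexp2l ?pint_p_gt1// ltnn.
  by rewrite mulrC ler_pdivrMr ?exprn_gt0 ?padic_pos// mul1r.
rewrite xE padic_absE// /pint_abs (negPf b0) invrK.
rewrite -[leRHS]mul1r ler_wpM2r ?exprn_ge0 ?(ltW (padic_pos _))//.
case: ifP => // _; rewrite invf_le1 ?exprn_gt0 ?padic_pos// exprn_ege1//.
by rewrite ler1n ltnW// pint_p_gt1.
Qed.

Lemma lev_absM j k (b x : padic p) : padic_abs rat b = (val p)%:R ^- j ->
  lev (j + k) (b * x) = lev k x.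
Proof.
move=> h; rewrite /lev padic_absM h exprD invfM.
by rewrite ler_pM2l// invr_gt0 exprn_gt0// padic_pos.
Qed.

Lemma lev_res k (a : padic_int p) : lev k (a%:F - (a k)%:~R).
Proof.
rewrite -(rmorph_int (@FracField.tofrac (padic_int p))) -tofracN -tofracD lev_tofrac.
rewrite pint_addE /= pint_int_res modzDmr; apply/eqP/dvdz_mod0P.
by rewrite pint_mod subrr dvdz0.
Qed.

(** Write [x = a / b] with [b] of order [j]. The residues of [a] and [b] are [v' p^j] and [u' p^j];
    Bezout inverts [u'] modulo [p^k], and [c] is the residue of [v' / u']. *)
Lemma lev_approx k (x : padic p) : lev 0 x ->
  exists2 c : nat, (c < (val p) ^ k)%N & lev k (x - c%:R).
Proof.
move=> lx; have := padic_numden x; set a := (repr x).1; set b := (repr x).2 => xE.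
have b0 : b != 0 by exact: denom_ratioP.
have [bj bj1] := pint_ordP b0; set j := pint_ord b in bj bj1.
have pq q : (0 < val p ^ q)%N by rewrite expn_gt0 (ltn_trans _ (pint_p_gt1 p)).
have ax : a%:F = b%:F * x by rewrite xE mulrC mulfVK// tofrac_eq0.
have aj : a j == 0.
  by rewrite -lev_tofrac ax -[j]addn0; apply: levM => //; rewrite lev_tofrac bj.
(* Residues are taken at level [j + k + 1], not [j + k]: this exceeds [j] even for [k = 0], so
   divisibility of [u'] by [p] would contradict the order of [b]. *)
have jk : (j <= j + k.+1)%N by exact: leq_addr.
have := pint_dvd b jk; rewrite bj eqxx => /dvdzP[u' uE].
have := pint_dvd a jk; rewrite aj => /dvdzP[v' vE].
have cop : coprimez u' ((val p ^ k)%N%:Z).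
  rewrite coprimezE absz_nat coprimeXr// coprime_sym prime_coprime; last exact: (valP p).
  apply/negP => pu; apply: bj1; apply/eqP.
  rewrite -lev_tofrac -[_%:F](subrK ((b (j + k.+1)%N)%:~R)).
  apply: levD; first by apply: lev_le (lev_res _ _); rewrite addnS ltnS leq_addr.
  by rewrite lev_int uE expnS PoszM dvdz_mul// dvdzE.
case: (Bezoutz u' ((val p ^ k)%N%:Z)) => s [t]; rewrite (eqP cop) => st.
have c_ge0 : 0 <= (s * v' %% (val p ^ k)%N%:Z)%Z by rewrite modz_ge0// gt_eqF// ltz_nat.
set c := `|(s * v' %% (val p ^ k)%N%:Z)%Z|%N.
have cE : c%:Z = (s * v' %% (val p ^ k)%N%:Z)%Z by rewrite /c gez0_abs.
exists c; first by rewrite -ltz_nat cE ltz_pmod// ltz_nat.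
rewrite -(@lev_absM j k b%:F); last first.
  by rewrite padic_abs_tofrac /pint_abs (negPf b0).
rewrite mulrBr -ax.
have le : (j + k <= j + k.+1)%N by rewrite leq_add2l.
set v := a (j + k.+1)%N in vE; set u := b (j + k.+1)%N in uE.
have -> : a%:F - b%:F * c%:R =
    (a%:F - v%:~R) - (b%:F - u%:~R) * c%:R + (v - u * c%:Z)%:~R :> padic p.
  by rewrite intrB intrM -pmulrn; ring.
apply: levD.
  apply: levB; first exact: lev_le le (lev_res _ _).
  by rewrite mulrC -[(j + k)%N]add0n; apply: levM; [exact: lev_nat0|exact: lev_le le (lev_res _ _)].
rewrite lev_int uE vE expnD PoszM mulrAC -mulrBl mulrC dvdz_mul//.
rewrite -eqz_mod_dvd cE modzMmr; apply/eqP.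
apply/eqP; rewrite eqz_mod_dvd.
have -> : v' - u' * (s * v') = v' * t * (val p ^ k)%N%:Z.
  by rewrite -[X in X - _](mulr1 v') -st; ring.
by rewrite dvdz_mull.
Qed.

End PadicLevel.

(** * Boxes *)

Lemma natinv_lt (R : archiRealFieldType) (q : nat) (e : R) : (1 < q)%N -> 0 < e ->
  exists k, q%:R ^- k < e.
Proof.
move=> q1 e0; exists (Num.truncn e^-1).+1.
rewrite invf_plt ?posrE ?exprn_gt0 ?ltr0n ?(ltn_trans _ q1)//.
apply: lt_le_trans (truncnS_gt _) _; rewrite -natrX ler_nat.
exact: ltnW (ltn_expl _ q1).
Qed.

Lemma nbhs_padic p (x : padic p) (A : set (padic p)) :
  nbhs x A <-> exists k, forall y, lev k (y - x) -> A y.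
Proof.
split=> [/nbhs_ballP[e /= e0 eA]|[k kA]].
  have [k ke] := natinv_lt (pint_p_gt1 p) e0.
  exists k => y yx; apply: eA; rewrite ballEmdist /=.
  by apply: le_lt_trans ke; move: yx; rewrite lev_distC.
apply/nbhs_ballP; exists ((val p)%:R ^- k); first by rewrite /= invr_gt0 exprn_gt0// padic_pos.
by move=> y; rewrite ballEmdist /= => yx; apply: kA; rewrite lev_distC; exact: ltW.
Qed.

Lemma nbhs_padic_row p n (x : 'rV[padic p]_n) (A : set 'rV[padic p]_n) :
  nbhs x A <-> exists k, forall y : 'rV[padic p]_n, (forall i, lev k (y 0 i - x 0 i)) -> A y.
Proof.
split=> [[P xP PA]|[k kA]].
  have /choice[r rP] (i : 'I_n) : exists k, forall y, lev k (y - x 0 i) -> P 0 i y.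
    by apply/nbhs_padic; exact: xP.
  exists (\max_i r i)%N => y yx; apply: PA => j i; rewrite ord1.
  by apply: rP; apply: lev_le (yx i); exact: leq_bigmax.
exists (fun j i => [set y | lev k (y - x j i)]) => [j i|y yx].
  by apply/nbhs_padic; exists k.
by apply: kA => i; exact: yx.
Qed.

Section Box.
Variables (T : {fset prime_nat}) (d : nat).
Implicit Types (a b : T * 'I_d -> nat) (x y z : QT T d) (A : set (QT T d)).

Definition box a x : set (QT T d) :=
  [set y | forall c, lev (a c) (y c.1 0 c.2 - x c.1 0 c.2)].

Lemma box_refl a x : box a x x.
Proof. by move=> c; rewrite subrr lev_zero. Qed.

Lemma box_sym a x y : box a x y -> box a y x.
Proof. by move=> h c; rewrite lev_distC. Qed.

Lemma box_trans a x y z : box a x y -> box a y z -> box a x z.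
Proof. by move=> h1 h2 c; rewrite -(subrKA (y c.1 0 c.2)) levD. Qed.

Lemma box_le a b x : (forall c, a c <= b c)%N -> box b x `<=` box a x.
Proof. by move=> ab y yx c; exact: lev_le (yx c). Qed.

Lemma box_eq a x y : box a x y -> box a y = box a x.
Proof.
move=> xy; apply/seteqP; split=> z; last exact: box_trans (box_sym xy).
exact: box_trans.
Qed.

(** These are the unions of boxes of levels [a], since boxes of equal levels coincide or are
    disjoint. *)
Definition invariant a A := forall x, A x -> box a x `<=` A.

Lemma box_invariant a x : invariant a (box a x).
Proof. by move=> y xy z; exact: box_trans. Qed.

(** The product topology is a supremum of pull-backs: the filter generated by cubes is tested on
    each factor, and conversely a cube is a finite intersection of preimages under the
    projections. *)
Lemma nbhs_box (x : QT T d) A :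
  nbhs x A <-> exists k, box (fun=> k) x `<=` A.
Proof.
pose F : set_system (QT T d) := [set B | exists k, box (fun=> k) x `<=` B].
have FF : Filter F.
  split; first by exists 0%N.
    move=> P Q [k kP] [j jQ]; exists (maxn k j) => y xy; split; [apply: kP|apply: jQ];
    by apply: box_le xy => c; rewrite ?leq_maxl ?leq_maxr.
  by move=> P Q PQ [k kP]; exists k; exact: subset_trans PQ.
split.
  suff : F --> x by apply.
  apply/cvg_sup => nu B [] _ [] [C oC <-] Cx CB.
  have /nbhs_padic_row[k kC] : nbhs (x nu) C by exact: open_nbhs_nbhs.
  by exists k => y xy; apply: CB; apply: kC => i; exact: (xy (nu, i)).
move=> [k kA]; apply: filterS kA _.
pose P (nu : T) := [set y : QT T d | forall i, lev k (y nu 0 i - x nu 0 i)].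
suff h : nbhs x [set y | forall nu, P nu y] by apply: filterS h => y h [nu i]; exact: h.
apply: (@filter_forall _ _ P (nbhs x)) => nu.
have hB : nbhs (x nu) [set r : 'rV[padic (val nu)]_d | forall i, lev k (r 0 i - x nu 0 i)].
  by apply/nbhs_padic_row; exists k.
exact: (@proj_continuous _ (fun nu : T => 'rV[padic (val nu)]_d) nu x _ hB).
Qed.

Lemma invariant_open a A : invariant a A -> open A.
Proof.
move=> iA; rewrite openE => x Ax; apply/nbhs_box.
exists (\max_c a c)%N; apply: subset_trans (iA _ Ax).
by apply: box_le => c; exact: leq_bigmax.
Qed.

Lemma open_measurable_QT A : open A -> measurable (A : set (borelQT T d)).
Proof. exact: sub_sigma_algebra. Qed.

Lemma invariant_measurable a A : invariant a A -> measurable (A : set (borelQT T d)).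
Proof. by move=> /invariant_open/open_measurable_QT. Qed.

Lemma box_measurable a x : measurable (box a x : set (borelQT T d)).
Proof. by apply: invariant_measurable; exact: box_invariant. Qed.

Definition shift (c : T * 'I_d) (t : nat) : QT T d :=
  fun nu => \row_i (if (nu, i) == c then t%:R else 0).

Lemma shiftE c t x c' :
  translate (shift c t) x c'.1 0 c'.2 = x c'.1 0 c'.2 + (if c' == c then t%:R else 0).
Proof. by rewrite /translate !mxE -surjective_pairing. Qed.

Definition upd a (c : T * 'I_d) (n : nat) c' := if c' == c then n else a c'.

Lemma box_translate a (u x y : QT T d) :
  box a (translate u x) (translate u y) <-> box a x y.
Proof.
have e c : translate u y c.1 0 c.2 - translate u x c.1 0 c.2 = y c.1 0 c.2 - x c.1 0 c.2.
  by rewrite /translate !mxE opprD addrACA subrr addr0.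
by split=> h c; have := h c; rewrite e.
Qed.

Lemma box_image_translate a (u x : QT T d) :
  translate u @` box a x = box a (translate u x).
Proof.
apply/seteqP; split=> [_ [y xy <-]|y xy]; first by apply/box_translate.
pose v : QT T d := fun nu => y nu - u nu.
have e : y = translate u v.
  by apply: functional_extensionality_dep => nu; rewrite /translate subrK.
exists v; last by rewrite e.
by apply: (box_translate a u x v).1; rewrite -e.
Qed.

(** The offset from [x] in coordinate [c], divided by [p^(a c)], is a p-adic integer; its residue
    modulo [p^(n - a c)] selects the piece. *)
Lemma box_split a c n x : (a c <= n)%N ->
  box a x = \bigcup_(t < (val (val c.1) ^ (n - a c))%N)
    box (upd a c n) (translate (shift c (t * val (val c.1) ^ a c)) x).
Proof.
move=> an; set p := val (val c.1); apply/seteqP; split=> y; last first.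
  move=> [t _ ty] c'; have := ty c'; rewrite shiftE /upd; case: eqVneq => [->|_]; last by rewrite addr0.
  move=> h; rewrite -[X in lev _ X](subrK ((t * p ^ a c)%:R)) -[X in lev _ (X + _)]addrA -opprD.
  apply: levD; first exact: lev_le h.
  by rewrite lev_nat dvdn_mull.
move=> xy; have := xy c.
have [|t tlt tlev] := @lev_approx (val c.1) (n - a c)
    (((p ^ a c)%N%:R)^-1 * (y c.1 0 c.2 - x c.1 0 c.2)).
  rewrite -(@lev_pM _ (a c)) addn0 mulrA mulfV ?mul1r//.
  apply/negP => /eqP e; have := lev_zero (val c.1) (a c).+1.
  by rewrite -e lev_nat dvdn_Pexp2l ?pint_p_gt1// ltnn.
move=> xyc; exists t => // c'; rewrite shiftE /upd; case: eqVneq => [->|_]; last first.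
  by rewrite addr0; exact: xy.
move: tlev; rewrite -(@lev_pM _ (a c)) mulrBr mulrA mulfV ?mul1r; last first.
  apply/negP => /eqP e; have := lev_zero (val c.1) (a c).+1.
  by rewrite -e lev_nat dvdn_Pexp2l ?pint_p_gt1// ltnn.
rewrite subnKC// -natrM mulnC.
by congr lev; rewrite opprD addrA.
Qed.

Lemma box_split_triv a c n x : (a c <= n)%N ->
  trivIset `I_((val (val c.1) ^ (n - a c))%N)
    (fun t => box (upd a c n) (translate (shift c (t * val (val c.1) ^ a c)) x)).
Proof.
move=> an; set p := val (val c.1).
suff h i j : (i < j < p ^ (n - a c))%N ->
    box (upd a c n) (translate (shift c (i * p ^ a c)) x) `&`
    box (upd a c n) (translate (shift c (j * p ^ a c)) x) !=set0 -> False.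
  move=> i j ilt jlt ij; have [lt|lt|//] := ltngtP i j; exfalso.
    by apply: h ij; rewrite lt.
  by rewrite setIC in ij; apply: h ij; rewrite lt.
move=> /andP[ij jlt] [y [/(_ c) hi /(_ c) hj]]; move: hi hj.
rewrite !shiftE eqxx /upd eqxx => hi hj.
have := levB hi hj.
rewrite [X in lev _ X](_ : _ = ((j * p ^ a c)%:R - (i * p ^ a c)%:R)); last by ring.
rewrite -natrB ?leq_mul2r ?(ltnW ij) ?orbT// lev_nat -mulnBl -(subnK an) expnD.
rewrite dvdn_pmul2r ?expn_gt0 ?(ltn_trans _ (pint_p_gt1 _))//.
move=> /dvdn_leq; rewrite subn_gt0 ij => /(_ isT); rewrite leqNgt => /negP; apply.
exact: leq_ltn_trans (leq_subr _ _) jlt.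
Qed.

End Box.

(** * Measures of boxes *)

Section BoxMeasure.
Variables (R : realType) (T : {fset prime_nat}) (d : nat).
Implicit Types (a : T * 'I_d -> nat) (c : T * 'I_d) (x y : QT T d).

Lemma translate_shiftD c s t x :
  translate (shift c s) (translate (shift c t) x) = translate (shift c (t + s)) x.
Proof.
apply: functional_extensionality_dep => nu; apply/rowP => i.
by rewrite /translate !mxE natrD; case: ifP => _; rewrite ?addr0 ?addrA.
Qed.

Lemma translate_surj (u y : QT T d) : exists x, translate u x = y.
Proof.
exists (fun nu => y nu - u nu).
by apply: functional_extensionality_dep => nu; rewrite /translate subrK.
Qed.

Lemma box_shift a c t x n : (a c <= n)%N -> box a x (translate (shift c (t * val (val c.1) ^ n)) x).
Proof.
move=> an c'; rewrite shiftE; case: eqVneq => [->|_]; last by rewrite addr0 subrr lev_zero.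
by rewrite addrAC subrr add0r lev_nat dvdn_mull// dvdn_exp2l.
Qed.

Lemma preimage_translate_invariant a (u : QT T d) (B : set (QT T d)) :
  invariant a B -> invariant a (translate u @^-1` B).
Proof. by move=> iB x Bx y xy; apply: iB Bx _ _; apply/box_translate. Qed.

Section Any.
Variable rho : {measure set (borelQT T d) -> \bar R}.

Lemma measure_box_split (B : set (borelQT T d)) a c n x : measurable B -> (a c <= n)%N ->
  rho (B `&` box a x) = (\sum_(t < (val (val c.1) ^ (n - a c))%N)
    rho (B `&` box (upd a c n) (translate (shift c (t * val (val c.1) ^ a c)) x)))%E.
Proof.
move=> mB an; rewrite (box_split x an) setI_bigcupr measure_fin_bigcup//.
- by rewrite -fsbig_ord.
- apply: trivIset_setIl; exact: box_split_triv.
- by move=> t _; apply: measurableI => //; exact: box_measurable.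
Qed.

End Any.

(** Coarsen one coordinate at a time from level [N] to level 0: both measures split along the same
    finitely many pieces, where the inequality is already known. *)
Lemma box_compare (m1 m2 : {measure set (borelQT T d) -> \bar R}) (r : R) N :
  0 <= r ->
  (forall x, r%:E * m1 (box (fun=> N) x) <= m2 (box (fun=> N) x))%E ->
  forall x, (r%:E * m1 (box (fun=> 0%N) x) <= m2 (box (fun=> 0%N) x))%E.
Proof.
move=> r0 h.
suff H (s : seq (T * 'I_d)) x :
    (r%:E * m1 (box (fun c => if c \in s then 0%N else N) x)
     <= m2 (box (fun c => if c \in s then 0%N else N) x))%E.
  move=> x; have := H (enum {: T * 'I_d}) x.
  have -> // : (fun c => if c \in enum {: T * 'I_d} then 0%N else N) = fun=> 0%N.
  by apply/funext => c; rewrite mem_enum.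
elim: s x => [//|c s IH] x; set a := (fun c' => _).
have an : (a c <= N)%N by rewrite /a in_cons eqxx.
have aE : upd a c N = fun c' => if c' == c then N else (if c' \in s then 0%N else N).
  by apply/funext => c'; rewrite /upd /a in_cons; case: eqP.
have [cs|cs] := boolP (c \in s).
  have -> : a = fun c => if c \in s then 0%N else N; last exact: IH.
  by apply/funext => c'; rewrite /a in_cons; case: eqP => // ->; rewrite cs.
have aE' : upd a c N = fun c' => if c' \in s then 0%N else N.
  by rewrite aE; apply/funext => c'; case: eqP => // ->; rewrite (negPf cs).
have e (m : {measure set (borelQT T d) -> \bar R}) := measure_box_split m x (@measurableT _ (borelQT T d)) an.
rewrite -[box a x]setTI !e ge0_sume_distrr; last by move=> i _; exact: measure_ge0.
by apply: lee_sum => t _; rewrite setTI aE'; exact: IH.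
Qed.

(** Restrict both measures to [C]: a cube of level [N] is either contained in [C] or null for the
    restrictions. *)
Lemma invariant_measure_le (m1 m2 : {measure set (borelQT T d) -> \bar R}) N
    (C : set (borelQT T d)) x : invariant (fun=> N) C ->
  (forall x, m1 (box (fun=> N) x) <= m2 (box (fun=> N) x))%E ->
  (m1 (C `&` box (fun=> 0%N) x) <= m2 (C `&` box (fun=> 0%N) x))%E.
Proof.
move=> iC h; have mC := invariant_measurable iC.
rewrite ![C `&` _]setIC -[leLHS]mul1e.
apply: (@box_compare (mrestr m1 mC) (mrestr m2 mC) 1 N ler01) => y.
rewrite mul1e /= /mrestr.
have [Cy|Cy] := pselect (C y).
  by rewrite setIidl//; exact: iC.
rewrite (_ : _ `&` C = set0) ?measure0//; rewrite -subset0 => z [yz Cz]; apply: Cy.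
exact: iC Cz _ (box_sym yz).
Qed.

(** * Approximation of measurable sets by unions of cubes of one level *)

Section Approximation.
Variable rho : {measure set (borelQT T d) -> \bar R}.
Hypothesis rho_fin : (rho setT < +oo)%E.

Lemma rho_lty (A : set (borelQT T d)) : measurable A -> (rho A < +oo)%E.
Proof. by move=> mA; apply: le_lt_trans rho_fin; apply: le_measure; rewrite ?inE. Qed.

Definition approximable (A : set (borelQT T d)) := forall e : R, 0 < e ->
  exists N (C : set (QT T d)), invariant (fun=> N) C /\ (rho (A `+` C) < e%:E)%E.

Lemma setY_setC2 (X : Type) (A B : set X) : ~` A `+` ~` B = A `+` B.
Proof.
rewrite /setY; apply/seteqP; split=> x /=; rewrite ?setDE /=;
  by move=> [[h1 h2]|[h1 h2]]; [right|left]; split => //; apply: contrapT.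
Qed.

Lemma invariantC a A : invariant a A -> invariant a (~` A).
Proof. by move=> iA x nAx y xy Ay; apply: nAx; exact: iA Ay _ (box_sym xy). Qed.

Lemma bigcup_approx (F : nat -> set (borelQT T d)) (e : R) : (forall n, measurable (F n)) ->
  nondecreasing_seq F -> 0 < e -> exists n, (rho ((\bigcup_k F k) `\` F n) < e%:E)%E.
Proof.
move=> mF ndF e0; set A := \bigcup_k F k.
have mA : measurable A by exact: bigcup_measurable.
have mG n : measurable (A `\` F n) by exact: measurableD.
have G0 : \bigcap_n (A `\` F n) = set0.
  rewrite -subset0 => x h; have [[k _ Fk] _] := h 0%N I.
  by have [_] := h k I.
have niG : nonincreasing_seq (fun n => A `\` F n).
  by move=> i j ij; apply/subsetPset; apply: setDS; apply/subsetPset/ndF.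
have := nonincreasing_cvg_mu (mu := rho) (F := fun n => A `\` F n).
rewrite G0 measure0 => /(_ (rho_lty (mG 0%N)) mG measurable0 niG) h.
have : \forall n \near \oo, (rho (A `\` F n) < e%:E)%E.
  apply: (h [set x | (x < e%:E)%E]); apply: open_nbhs_nbhs; split; last by rewrite /= lte_fin.
  exact: open_ereal_lt_ereal.
by move=> [n _ /(_ n (leqnn n))]; exists n.
Qed.

Lemma measurable_setY (A B : set (borelQT T d)) : measurable A -> measurable B ->
  measurable (A `+` B).
Proof. by move=> mA mB; apply: measurableU; exact: measurableD. Qed.

Lemma approximable_lim (A : set (borelQT T d)) : measurable A ->
  (forall e : R, 0 < e -> exists B, [/\ measurable B, approximable B & (rho (A `+` B) < e%:E)%E]) ->
  approximable A.
Proof.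
move=> mA h e e0; have e2 : 0 < e / 2 by rewrite divr_gt0.
have [B [mB aB AB]] := h _ e2; have [N [C [iC BC]]] := aB _ e2.
exists N, C; split=> //; have mC := invariant_measurable iC.
have mAB := measurable_setY mA mB; have mBC := measurable_setY mB mC.
apply: (@le_lt_trans _ _ (rho ((A `+` B) `|` (B `+` C)))).
  apply: le_measure; rewrite ?inE; [exact: measurable_setY|exact: measurableU|].
  move=> x [[h1 h2]|[h1 h2]]; have [Bx|Bx] := pselect (B x).
  - by right; left.
  - by left; left.
  - by left; right.
  - by right; right.
apply: le_lt_trans (measureU2 _ mAB mBC) _.
by rewrite (splitr e) EFinD lteD.
Qed.

Lemma approximable_invariant N (A : set (QT T d)) : invariant (fun=> N) A -> approximable A.
Proof.
move=> iA e e0; exists N, A; split=> //.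
by rewrite /setY !setDv setU0 measure0.
Qed.

Lemma approximable_open (A : set (QT T d)) : open A -> approximable A.
Proof.
move=> oA; apply: approximable_lim; first exact: open_measurable_QT.
(* The points whose cube of level [n] lies in [A] form a union of such cubes, and these sets
   increase to [A] because [A] is open. *)
move=> e e0; pose F n : set (borelQT T d) := [set x | box (fun=> n) x `<=` A].
have iF n : invariant (fun=> n) (F n).
  by move=> x Fx y xy z yz; apply: Fx; exact: box_trans yz.
have mF n := invariant_measurable (iF n).
have FA : \bigcup_n F n = A.
  apply/seteqP; split=> [x [n _]|x Ax]; first by apply; exact: box_refl.
  have /nbhs_box[k kA] : nbhs x A by exact: open_nbhs_nbhs.
  by exists k.
have ndF : nondecreasing_seq F.
  move=> i j ij; apply/subsetPset => x Fx; apply: subset_trans Fx.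
  by apply: box_le => _.
have [n] := bigcup_approx mF ndF e0; rewrite FA => h.
exists (F n); split=> //; first exact: approximable_invariant (iF n).
rewrite /setY [F n `\` A](_ : _ = set0) ?setU0//.
by rewrite -subset0 => x [Fx]; apply; rewrite -FA; exists n.
Qed.

Lemma approximableU (A B : set (borelQT T d)) : measurable A -> measurable B ->
  approximable A -> approximable B -> approximable (A `|` B).
Proof.
move=> mA mB aA aB e e0; have e2 : 0 < e / 2 by rewrite divr_gt0.
have [N [C [iC AC]]] := aA _ e2; have [M [D [iD BD]]] := aB _ e2.
have mC := invariant_measurable iC; have mD := invariant_measurable iD.
exists (maxn N M), (C `|` D); split.
  move=> x [Cx|Dx] y xy; [left|right].
    by apply: iC Cx _ _; apply: box_le xy => _; exact: leq_maxl.
  by apply: iD Dx _ _; apply: box_le xy => _; exact: leq_maxr.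
have mAC := measurable_setY mA mC; have mBD := measurable_setY mB mD.
apply: (@le_lt_trans _ _ (rho ((A `+` C) `|` (B `+` D)))).
  apply: le_measure; rewrite ?inE; [|exact: measurableU|].
    by apply: measurable_setY; exact: measurableU.
  move=> x [[[h1|h1] /not_orP[h2 h3]]|[[h1|h1] /not_orP[h2 h3]]].
  - by left; left.
  - by right; left.
  - by left; right.
  - by right; right.
apply: le_lt_trans (measureU2 _ mAC mBD) _.
by rewrite (splitr e) EFinD lteD.
Qed.

(** The approximable measurable sets form a sigma-algebra containing the open sets; countable unions
    reduce to finite ones by continuity from above, as [rho] is finite. *)
Lemma measurable_approximable (A : set (borelQT T d)) : measurable A -> approximable A.
Proof.
suff h : measurable `<=` [set B : set (borelQT T d) | measurable B /\ approximable B].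
  by move=> /h[].
apply: smallest_sub; last first.
  by move=> B oB; split; [exact: open_measurable_QT|exact: approximable_open].
split.
- split; first exact: measurable0.
  by apply: (@approximable_invariant 0) => x.
- move=> B [mB aB]; split; first by rewrite setTD; exact: measurableC.
  move=> e /aB[N [C [iC BC]]]; exists N, (~` C); split; first exact: invariantC.
  by rewrite setTD setY_setC2.
move=> F FP; have mF n := (FP n).1.
split; first exact: bigcupT_measurable.
apply: approximable_lim => [|e e0]; first exact: bigcupT_measurable.
pose G n : set (borelQT T d) := \bigcup_(i < n) F i.
have mG n : measurable (G n) by apply: bigcup_measurable => i _.
have GF : \bigcup_n G n = \bigcup_n F n.
  apply/seteqP; split=> x [n _]; first by move=> [i _ Fi]; exists i.
  by move=> Fn; exists n.+1 => //; exists n => /=.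
have ndG : nondecreasing_seq G.
  move=> i j ij; apply/subsetPset => x [k ki Fk]; exists k => //=.
  exact: leq_trans ki ij.
have [n] := bigcup_approx mG ndG e0; rewrite GF => h.
exists (G n); split=> //.
  elim: n {h} => [|n IH].
    by apply: (@approximable_invariant 0) => x [].
  have -> : G n.+1 = G n `|` F n.
    apply/seteqP; split=> x.
      move=> [i /=]; rewrite ltnS leq_eqVlt => /orP[/eqP ->|]; first by right.
      by left; exists i.
    move=> [[i /= ilt Fi]|Fn]; first by exists i => //=; exact: ltnW.
    by exists n => /=.
  by apply: approximableU => //; exact: (FP n).2.
rewrite /setY [G n `\` _](_ : _ = set0) ?setU0//.
by rewrite -subset0 => x [Gx]; apply; rewrite -GF; exists n.
Qed.

End Approximation.
End BoxMeasure.

(** * The strong density theorem *)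

Section Haar.
Variables (R : realType) (T : {fset prime_nat}) (d : nat).
Variable mu : {measure set (borelQT T d) -> \bar R}.
Hypothesis mu_translate : forall (A : set (borelQT T d)) (u : QT T d),
  measurable A -> mu (translate u @` A) = mu A.
Let o : QT T d := fun=> 0.
Hypothesis mu_unit : mu (box (fun=> 0%N) o) = 1%E.
Implicit Types (a : T * 'I_d -> nat) (c : T * 'I_d) (x y : QT T d).

Local Notation q c := (val (val c.1)).

Lemma sume_const_ord n (x : \bar R) : (\sum_(i < n) x = n%:R%:E * x)%E.
Proof. by rewrite sumr_const card_ord mule_natl. Qed.

Lemma q_gt0 c (F : numDomainType) n : 0 < (q c)%:R ^+ n :> F.
Proof. by rewrite exprn_gt0// ltr0n (ltn_trans _ (pint_p_gt1 _)). Qed.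

Definition vol a : R := \prod_c (q c)%:R ^- a c.

Lemma vol_gt0 a : 0 < vol a.
Proof. by apply: prodr_gt0 => c _; rewrite invr_gt0 q_gt0. Qed.

Lemma vol_upd a c n : (a c <= n)%N -> vol a = ((q c) ^ (n - a c))%:R * vol (upd a c n).
Proof.
move=> an; rewrite /vol (bigD1 c)//= [in RHS](bigD1 c)//= mulrA /upd eqxx; congr (_ * _).
  by rewrite natrX -[in X in _ / X](subnK an) exprD invfM mulrA mulfV ?mul1r// gt_eqF// q_gt0.
by apply: eq_bigr => c' /negPf ->.
Qed.

(** Refine the unit cube one coordinate at a time: the pieces of each split are translates of one
    another, so they have equal measure. *)
Lemma mu_box a x : mu (box a x) = (vol a)%:E.
Proof.
have -> : box a x = translate x @` box a o.
  rewrite box_image_translate; congr box.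
  by apply: functional_extensionality_dep => nu; rewrite /translate add0r.
rewrite mu_translate; last exact: box_measurable.
suff H (s : seq (T * 'I_d)) : uniq s ->
    mu (box (fun c => if c \in s then a c else 0%N) o) = (\prod_(c <- s) (q c)%:R ^- a c)%:E.
  have := H _ (enum_uniq {: T * 'I_d}); rewrite big_enum /= => <-.
  by congr (mu (box _ _)); apply/funext => c; rewrite mem_enum.
elim: s => [_|c s IH /= /andP[cs us]]; first by rewrite big_nil.
rewrite big_cons; set b := fun c' => if c' \in c :: s then a c' else 0%N.
set b' := (fun c' => if c' \in s then a c' else 0%N) in IH.
have b'c : b' c = 0%N by rewrite /b' (negPf cs).
have bE : upd b' c (a c) = b.
  by apply/funext => c'; rewrite /b /upd /b' in_cons; case: eqP => // ->.
have bc : (b' c <= a c)%N by rewrite b'c.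
have e1 t : mu (box b (translate (shift c (t * q c ^ 0)) o)) = mu (box b o).
  rewrite -[RHS](@mu_translate _ (shift c (t * q c ^ 0))); last exact: box_measurable.
  by rewrite box_image_translate.
have := measure_box_split mu o (@measurableT _ (borelQT T d)) bc.
rewrite setTI (IH us) b'c subn0 bE => e.
have {}e : ((\prod_(j <- s) (q j)%:R ^- a j)%:E = ((q c ^ a c)%:R)%:E * mu (box b o))%E.
  rewrite e (eq_bigr (fun=> mu (box b o))) => [|t _]; last by rewrite setTI e1.
  by rewrite sume_const_ord.
by rewrite EFinM e muleA -EFinM natrX mulVf ?mul1e// gt_eqF// q_gt0.
Qed.

(** * Maximal inequalities, one coordinate at a time *)

Lemma mu_preimage (u : QT T d) (B : set (borelQT T d)) :
  measurable (translate u @^-1` B : set (borelQT T d)) -> mu (translate u @^-1` B) = mu B.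
Proof.
move=> mB; rewrite -(mu_translate u mB); congr (mu _).
apply/seteqP; split=> [_ [x Bx <-]//|y By].
by have [x xy] := translate_surj u y; exists x => //; rewrite /= xy.
Qed.

Lemma measure_count (n : nat) (r : R) (D : set (borelQT T d)) (B : nat -> set (borelQT T d)) :
  0 <= r -> measurable D -> (forall t, measurable (B t)) ->
  (forall x, D x -> r <= \sum_(t < n) \1_(B t) x) ->
  (r%:E * mu D <= \sum_(t < n) mu (B t `&` D))%E.
Proof.
move=> r0 mD mB h; rewrite -integral_cst//.
rewrite (eq_bigr (fun t : 'I_n => \int[mu]_(x in D) (\1_(B t) x)%:E)%E); last first.
  by move=> t _; rewrite integral_indic.
have mf (t : 'I_n) : measurable_fun D (EFin \o (\1_(B t) : borelQT T d -> R)).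
  by apply/measurable_EFinP; exact: measurable_indic.
have f0 (t : 'I_n) x : D x -> (0 <= (\1_(B t) x)%:E :> \bar R)%E.
  by move=> _; rewrite lee_fin indicE ler0n.
rewrite -(ge0_integral_sum mu mD mf f0).
apply: ge0_le_integral => //.
- by apply: emeasurable_sum.
- by move=> x Dx; rewrite sumEFin lee_fin /=; exact: h.
Qed.

(** If [B] is a union of cubes of level [N], dividing this by [q^(N - a)] gives the average of [B]
    over the ball of level [a] through [x] in coordinate [c] alone. It stands for an integral along
    one coordinate. *)
Definition cnt (B : set (QT T d)) c N (a : nat) x : R :=
  \sum_(t < (q c ^ (N - a))%N) \1_B (translate (shift c (t * q c ^ a)) x).

Lemma sum_periodic (g : nat -> R) n k : (forall i, g (i + n)%N = g i) ->
  \sum_(i < n) g (i + k)%N = \sum_(i < n) g i.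
Proof.
move=> gn; elim: k => [|k <-]; first by apply: eq_bigr => i _; rewrite addn0.
case: n gn => [|n] gn; first by rewrite !big_ord0.
rewrite big_ord_recr [in RHS]big_ord_recl /= addrC; congr (_ + _).
  by rewrite add0n -[RHS]gn addnC addnS -addSn.
by apply: eq_bigr => i _; rewrite /bump /= add1n addnS addSn.
Qed.

Lemma shift_level0 c N x t : box (fun=> N) x (translate (shift c (t * q c ^ N)) x).
Proof. exact: box_shift. Qed.

Lemma invariant_iff a (B : set (QT T d)) x y : invariant a B -> box a x y -> B x <-> B y.
Proof. by move=> iB xy; split=> [/iB|/iB]; apply => //; exact: box_sym. Qed.

Lemma indic_iff (X : Type) (A B : set X) (x y : X) : (A x <-> B y) -> \1_A x = \1_B y :> R.
Proof. by move=> h; rewrite !indicE; congr ((nat_of_bool _)%:R); apply/idP/idP; rewrite !inE => /h. Qed.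

(** The summand is periodic in the index, because a shift by [q^N] stays in the same cube of level
    [N], and the sum runs over one full period. *)
Lemma cnt_shift B c N (a b : nat) t x : invariant (fun=> N) B -> (a <= b)%N -> (a <= N)%N ->
  cnt B c N a (translate (shift c (t * q c ^ b)) x) = cnt B c N a x.
Proof.
move=> iB ab aN; rewrite /cnt.
pose g i := \1_B (translate (shift c (i * q c ^ a)) x) : R.
have -> : (t * q c ^ b = (t * q c ^ (b - a)) * q c ^ a)%N by rewrite -mulnA -expnD subnK.
rewrite -[RHS](@sum_periodic g _ (t * q c ^ (b - a))%N).
  by apply: eq_bigr => i _; rewrite translate_shiftD -mulnDl addnC.
move=> i; apply: indic_iff; rewrite mulnDl -expnD subnK// -translate_shiftD.
set y := translate (shift c (i * q c ^ a)) x.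
have := shift_level0 c N y 1; rewrite mul1n => h.
exact: iff_sym (invariant_iff iB h).
Qed.

Lemma cnt_invariant B c N (a : nat) x y : invariant (fun=> N) B -> box (fun=> N) x y ->
  cnt B c N a x = cnt B c N a y.
Proof.
move=> iB xy; apply: eq_bigr => t _; apply: indic_iff; apply: (invariant_iff iB).
by apply/box_translate.
Qed.

(* Weak type (1,1) of the maximal operator in one coordinate: the set splits
   into the pieces [D a] on which [a] is the coarsest level with a large average. *)
Lemma weak_type (B : set (borelQT T d)) c N (r : R) : invariant (fun=> N) B -> 0 < r ->
  (r%:E * mu [set x | exists2 a : nat, (a <= N)%N & (r * (q c ^ (N - a))%:R < cnt B c N a x)%R]
   <= mu B)%E.
Proof.
move=> iB r0; set B1 := [set x | _].
pose P (a : nat) x := r * (q c ^ (N - a))%:R < cnt B c N a x.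
pose D (a : nat) : set (borelQT T d) := [set x | [/\ (a <= N)%N, P a x & forall b, (b < a)%N -> ~ P b x]].
have mB : measurable B by exact: invariant_measurable iB.
have iD (a : nat) : invariant (fun=> N) (D a).
  move=> x [aN Px nP] y xy; split=> //; first by rewrite /P -(cnt_invariant _ _ iB xy).
  by move=> b /nP; rewrite /P -(cnt_invariant _ _ iB xy).
have mD (a : nat) : measurable (D a) by exact: invariant_measurable (iD a).
have tD : trivIset setT D.
  move=> a b _ _ [x [[aN Pa na] [bN Pb nb]]]; have [ab|ab|//] := ltngtP a b.
    by case: (nb _ ab).
  by case: (na _ ab).
have B1E : B1 = \bigcup_(a < N.+1) D a.
  apply/seteqP; split=> x.
    move=> [a aN Pa].
    have ex : exists b, `[< P b x >] by exists a; apply/asboolP.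
    exists (ex_minn ex); case: ex_minnP => b /asboolP Pb bmin.
      by rewrite /= ltnS (leq_trans (bmin a _))//; exact/asboolP.
    split=> //; first by rewrite (leq_trans (bmin a _))//; exact/asboolP.
    by move=> b' b'b /asboolP /bmin; rewrite leqNgt b'b.
  by move=> [a _ [aN Pa _]]; exists a.
have shiftD (a : nat) t x : (a <= N)%N -> D a (translate (shift c (t * q c ^ a)) x) <-> D a x.
  move=> aN; split=> -[_ Pa na]; split=> //.
  - by move: Pa; rewrite /P cnt_shift.
  - by move=> b ba; have := na _ ba; rewrite /P cnt_shift// ltnW// (leq_trans ba).
  - by rewrite /P cnt_shift.
  - by move=> b ba; have := na _ ba; rewrite /P cnt_shift// ltnW// (leq_trans ba).
(* Shifts by multiples of [q^a] preserve [D a], so all [n] translates of [B] meet [D a] in the same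
   measure; integrating the count over [D a] and cancelling [n] gives the bound. *)
have Dle (a : nat) : (a <= N)%N -> (r%:E * mu (D a) <= mu (B `&` D a))%E.
  move=> aN; set n := (q c ^ (N - a))%N.
  have n0 : (0 < n)%N by rewrite expn_gt0 (ltn_trans _ (pint_p_gt1 _)).
  pose E t : set (borelQT T d) := translate (shift c (t * q c ^ a)) @^-1` B.
  have mE t : measurable (E t).
    by apply: (@invariant_measurable _ _ (fun=> N)); exact: preimage_translate_invariant.
  have := @measure_count n (r * n%:R) (D a) E.
  rewrite mulr_ge0 ?ler0n ?(ltW r0)// => /(_ isT (mD a) mE) h.
  have {}h : ((r * n%:R)%:E * mu (D a) <= \sum_(t < n) mu (E t `&` D a))%E.
    by apply: h => x [_ Px _]; exact: ltW.
  have e t : mu (E t `&` D a) = mu (B `&` D a).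
    have -> : E t `&` D a = translate (shift c (t * q c ^ a)) @^-1` (B `&` D a).
      by apply/seteqP; split=> x [h1 h2]; split=> //; apply/(shiftD a t x aN).
    apply: mu_preimage; apply: (@invariant_measurable _ _ (fun=> N)).
    apply: preimage_translate_invariant => x [Bx Dx] y xy; split; first exact: iB Bx _ xy.
    exact: iD Dx _ xy.
  move: h; rewrite (eq_bigr (fun=> mu (B `&` D a))) => [|t _]; last exact: e.
  rewrite sume_const_ord mulrC EFinM -muleA.
  by rewrite lee_pmul2l// lte_fin ltr0n.
have mu1 : mu B1 = (\sum_(a < N.+1) mu (D a))%E.
  rewrite B1E measure_fin_bigcup//; last exact: sub_trivIset tD.
  by rewrite -fsbig_ord.
rewrite mu1 ge0_sume_distrr; last by move=> i _; exact: measure_ge0.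
apply: (@le_trans _ _ (\sum_(a < N.+1) mu (B `&` D a))%E).
  by apply: lee_sum => a _; apply: Dle; rewrite -ltnS.
have <- : mu (\bigcup_(a < N.+1) (B `&` D a)) = (\sum_(a < N.+1) mu (B `&` D a))%E.
  rewrite measure_fin_bigcup//; first by rewrite -fsbig_ord.
    apply: trivIset_setIl; exact: sub_trivIset tD.
  by move=> a _; exact: measurableI.
apply: le_measure; rewrite ?inE//; last by move=> x [a _ []].
by apply: bigcup_measurable => a _; exact: measurableI.
Qed.

(** Coordinates outside [s] are frozen at the finest level [N], so an induction on [s] frees one
    direction at a time. *)
Definition maxset (s : seq (T * 'I_d)) N (B : set (borelQT T d)) (r : R) :=
  [set x : QT T d | exists a, [/\ forall c, (a c <= N)%N, forall c, c \notin s -> a c = N &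
    ((r * vol a)%:E < mu (B `&` box a x))%E]].

Lemma maxset_invariant s N B r : invariant (fun=> N) (maxset s N B r).
Proof.
move=> x [a [aN sa h]] y xy; exists a; split=> //.
by rewrite (@box_eq _ _ a x y)//; apply: box_le xy => c; exact: aN.
Qed.

Lemma maxset_nil N (B : set (borelQT T d)) (r : R) : measurable B ->
  B `<=` box (fun=> 0%N) o -> 0 < r -> (r%:E * mu (maxset [::] N B r) <= mu B)%E.
Proof.
move=> mB Bo r0; set D := maxset _ _ _ _.
have iD : invariant (fun=> N) D := @maxset_invariant _ _ _ _.
have mD : measurable (D : set (borelQT T d)) by exact: invariant_measurable iD.
have mBD : measurable (B `&` D : set (borelQT T d)) by exact: measurableI.
have Do : D `&` box (fun=> 0%N) o = D.
  apply/setIidl => x [a [_ _ h]].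
  have [y [By xy]] : B `&` box a x !=set0.
    apply/set0P/eqP => e; move: h; rewrite e measure0 lte_fin.
    by rewrite ltNge mulr_ge0// ?ltW// vol_gt0.
  by apply: box_trans (Bo _ By) _; apply: box_le (box_sym xy) => c.
have := @box_compare R T d (mrestr mu mD) (mrestr mu mBD) r N (ltW r0) _ o.
rewrite /mrestr => h; have {}h : (r%:E * mu (box (fun=> 0%N) o `&` D) <= mu (box (fun=> 0%N) o `&` (B `&` D)))%E.
  apply: h => x; rewrite /= /mrestr; have [Dx|Dx] := pselect (D x); last first.
    rewrite (_ : box _ x `&` D = set0) ?measure0 ?mule0//.
    by rewrite -subset0 => z [xz Dz]; apply: Dx; exact: iD Dz _ (box_sym xz).
  have sub : box (fun=> N) x `<=` D by exact: iD.
  rewrite (setIidl sub) setIC -setIA [D `&` _]setIidr// mu_box -EFinM.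
  case: Dx => a [aN sa]; rewrite (_ : a = fun=> N); first exact: ltW.
  by apply/funext => c; exact: sa.
move: h; rewrite setIC Do => /le_trans; apply.
apply: le_measure; rewrite ?inE; [|exact: mB|by move=> x [_ []]].
by apply: measurableI => //; exact: box_measurable.
Qed.

(** Cut a box of average above [r] into slices of level [N] in direction [c]. A slice outside [B1],
    the maximal set of the other directions at [r / 2], has average at most [r / 2], and any slice
    has average at most 1; hence more than the proportion [r / 2] of slices lies in [B1], and
    [weak_type] applies to [B1]. *)
Lemma maximal (s : seq (T * 'I_d)) (r : R) : 0 < r ->
  exists2 K : R, 0 <= K & forall N (B : set (borelQT T d)), measurable B ->
  B `<=` box (fun=> 0%N) o -> (mu (maxset s N B r) <= K%:E * mu B)%E.
Proof.
elim: s r => [|c s IH] r r0.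
  exists r^-1; first by rewrite invr_ge0 ltW.
  move=> N B mB Bo; have := maxset_nil N mB Bo r0.
  rewrite -(@lee_pmul2l _ r^-1%:E) ?lte_fin ?invr_gt0//.
  by rewrite muleA -EFinM mulVf ?mul1e// gt_eqF.
have r2 : 0 < r / 2 by rewrite divr_gt0.
have [K K0 hK] := IH _ r2.
exists ((r / 2)^-1 * K); first by rewrite mulr_ge0// invr_ge0 ltW.
move=> N B mB Bo; set B1 := maxset s N B (r / 2).
have iB1 : invariant (fun=> N) B1 := @maxset_invariant _ _ _ _.
have := weak_type c iB1 r2; set B2 := [set x | _] => hB2.
have mB2 : measurable (B2 : set (borelQT T d)).
  apply: (@invariant_measurable _ _ (fun=> N)) => x [a aN h] y xy; exists a; first exact: aN.
  by rewrite -(cnt_invariant c a iB1 xy); exact: h.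
have sub : maxset (c :: s) N B r `<=` B2.
  move=> x [a [aN sa h]]; exists (a c); first exact: aN.
  pose a' := upd a c N.
  have sa' c' : c' \notin s -> a' c' = N.
    rewrite /a' /upd; case: eqP => // /eqP cc' cs; apply: sa.
    by rewrite in_cons negb_or cc'.
  have a'N c' : (a' c' <= N)%N by rewrite /a' /upd; case: eqP.
  move: h; rewrite (measure_box_split mu x mB (aN c)) (vol_upd (aN c)) -/a'.
  set n := (q c ^ (N - a c))%N.
  pose y t := translate (shift c (t * q c ^ a c)) x.
  have le (t : 'I_n) : (mu (B `&` box a' (y t)) <= (r / 2 * vol a')%:E + (\1_B1 (y t) * vol a')%:E)%E.
    have [B1y|B1y] := pselect (B1 (y t)).
      rewrite indicE mem_set// mul1r; apply: (@le_trans _ _ (mu (box a' (y t)))).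
        by apply: le_measure; rewrite ?inE; [apply: measurableI => //|..]; try exact: box_measurable.
      by rewrite mu_box lee_fin lerDr mulr_ge0// ltW// vol_gt0.
    rewrite indicE memNset// mul0r adde0 leNgt; apply/negP => h; apply: B1y.
    by exists a'.
  move=> h; have {h} := lt_le_trans h (lee_sum _ (fun t _ => le t)).
  rewrite big_split /= sume_const_ord sumEFin -mulr_suml -EFinM -EFinD lte_fin.
  rewrite [r * _]mulrCA mulrA -/n [n%:R * (_ * _)]mulrA -mulrDl ltr_pM2r ?vol_gt0//.
  move=> h; rewrite /cnt -/n; lra.
apply: (@le_trans _ _ (mu B2)).
  apply: le_measure; rewrite ?inE//; apply: (@invariant_measurable _ _ (fun=> N)).
  exact: maxset_invariant.
have inv0 : 0 < (r / 2)^-1 by rewrite invr_gt0.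
rewrite -(@lee_pmul2l _ (r / 2)%:E) ?lte_fin//.
apply: (le_trans hB2); rewrite muleA -EFinM mulrA mulfV ?gt_eqF// mul1r.
exact: hK.
Qed.

(** * Density along boxes of unequal sides *)

Lemma negligible_le (E : set (borelQT T d)) :
  (forall e : R, 0 < e -> exists M : set (borelQT T d),
    [/\ measurable M, E `<=` M & (mu M <= e%:E)%E]) -> mu.-negligible E.
Proof.
move=> h; have /choice[M MP] (n : nat) : exists M : set (borelQT T d),
    [/\ measurable M, E `<=` M & (mu M <= (n.+1%:R^-1)%:E)%E].
  by apply: h; rewrite invr_gt0.
have mM : measurable (\bigcap_n M n) by apply: bigcapT_measurable => n; have [] := MP n.
exists (\bigcap_n M n); split=> //; last by move=> x Ex n _; have [_ + _] := MP n; apply.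
apply/eqP; rewrite eq_le measure_ge0 andbT; apply/lee_addgt0Pr => e e0.
have [k ke] := natinv_lt (isT : (1 < 2)%N) e0.
rewrite add0e; have [mMk _ Mk] := MP (2 ^ k)%N.
apply: (@le_trans _ _ (mu (M (2 ^ k)%N))).
  by apply: le_measure; rewrite ?inE// => x; apply.
apply: (le_trans Mk); rewrite lee_fin; apply: le_trans (ltW ke).
by rewrite -natrX lef_pV2 ?posrE ?ltr0n ?expn_gt0// ler_nat.
Qed.

(** Approximate [A] by a union [C] of cubes of level [N0]. A finer box around a point of [C] lies in
    [C], so the part of it missed by [A] belongs to the symmetric difference [B]; [B] then has a
    large average there, and [maximal] bounds the set of such points. *)
Lemma density (A : set (borelQT T d)) (eta : R) : measurable A ->
  A `<=` box (fun=> 0%N) o -> 0 < eta ->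
  mu.-negligible [set x | A x /\ forall N, exists a, (forall c, N <= a c)%N /\
    (mu (A `&` box a x) <= ((1 - eta) * vol a)%:E)%E].
Proof.
move=> mA Ao eta0; set E := [set x | _]; apply: negligible_le => e e0.
(* Half of [eta], because [maxset] asks for a strict inequality. *)
have eta2 : 0 < eta / 2 by rewrite divr_gt0.
have [K K0 hK] := maximal (enum {: T * 'I_d}) eta2.
have mo := box_measurable (fun=> 0%N) o.
have rho_fin : (mrestr mu mo setT < +oo)%E by rewrite /mrestr setTI mu_unit ltry.
(* The 1 pays for the points of [A] outside [C], the [K] for the maximal set. *)
have eK : 0 < e / (1 + K) by rewrite divr_gt0// ltr_pwDl.
have [N0 [C [iC AC]]] := measurable_approximable rho_fin mA eK.
set B := (A `+` C) `&` box (fun=> 0%N) o.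
have {}AC : (mu B < (e / (1 + K))%:E)%E by exact: AC.
have mC := invariant_measurable iC.
have mB : measurable (B : set (borelQT T d)).
  by apply: measurableI => //; exact: measurable_setY.
have Bo : B `<=` box (fun=> 0%N) o by move=> x [].
pose F N : set (borelQT T d) := maxset (enum {: T * 'I_d}) N B (eta / 2).
have mF N : measurable (F N).
  by apply: invariant_measurable; exact: maxset_invariant.
have mFU : measurable (\bigcup_N F N) by exact: bigcupT_measurable.
have ndF : nondecreasing_seq F.
  move=> i j ij; apply/subsetPset => x [a [ai _ h]]; exists a; split=> //.
    by move=> c; exact: leq_trans (ai c) ij.
  by move=> c; rewrite mem_enum.
(* The constant of [maximal] is uniform in [N], so the bound passes to the increasing union, which
   allows boxes of all levels. *)
have FU : (mu (\bigcup_N F N) <= K%:E * mu B)%E.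
  have h := nondecreasing_cvg_mu (mu := mu) mF mFU ndF.
  rewrite -(cvg_lim _ h)//; apply: lime_le; first by apply/cvg_ex; exists (mu (\bigcup_N F N)).
  by near=> n; exact: hK.
exists (B `|` \bigcup_N F N); split; first exact: measurableU.
  move=> x [Ax /(_ N0)[a [aN0 h]]]; have [Cx|Cx] := pselect (C x); last first.
    by left; split; [left|exact: Ao].
  right; exists (\max_c a c)%N => //; exists a; split.
  - by move=> c; exact: leq_bigmax.
  - by move=> c; rewrite mem_enum.
  have sC : box a x `<=` C.
    by apply: subset_trans (iC _ Cx); apply: box_le.
  have so : box a x `<=` box (fun=> 0%N) o.
    by move=> y xy; apply: box_trans (Ao _ Ax) _; apply: box_le xy.
  have mb := box_measurable a x.
  have le1 : (mu (box a x `\` A) <= mu (B `&` box a x))%E.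
    apply: le_measure; rewrite ?inE; [exact: measurableD|exact: measurableI|].
    by move=> y [xy nA]; split=> //; split; [right; split=> //; exact: sC|exact: so].
  apply: lt_le_trans le1.
  have e1 : ((vol a)%:E = mu (box a x `\` A) + mu (A `&` box a x))%E.
    by rewrite -(mu_box a x) [A `&` _]setIC; exact: measureDI.
  have fA : mu (A `&` box a x) \is a fin_num.
    rewrite ge0_fin_numE//; apply: le_lt_trans h _; exact: ltry.
  have fD : mu (box a x `\` A) \is a fin_num.
    rewrite ge0_fin_numE//; apply: (@le_lt_trans _ _ (mu (box a x))).
      by apply: le_measure; rewrite ?inE//; exact: measurableD.
    by rewrite mu_box ltry.
  move: e1 h; rewrite -(fineK fA) -(fineK fD) -EFinD !lee_fin lte_fin => -[e1] h.
  by have v0 := vol_gt0 a; have := mulr_gt0 eta0 v0; lra.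
apply: (le_trans (measureU2 _ mB mFU)).
apply: (@le_trans _ _ (mu B + K%:E * mu B)%E); first by rewrite leeD2l.
have fB : mu B \is a fin_num by rewrite ge0_fin_numE// (lt_trans AC)// ltry.
move: AC; rewrite -(fineK fB) -EFinM -EFinD lte_fin lee_fin ltr_pdivlMr ?ltr_pwDl//.
by move=> /ltW; rewrite mulrDr mulr1 [K * _]mulrC.
Unshelve. all: by end_near. Qed.

End Haar.

(** * Projections to fewer primes *)

Section Projection.
Variables (R : realType) (T T' : {fset prime_nat}) (d : nat).
Hypothesis TT : (T' `<=` T)%fset.

Definition restr (x : QT T d) : QT T' d := fun nu => x (fincl TT nu).

Lemma restr_open (B : set (QT T' d)) : open B -> open (restr @^-1` B).
Proof.
move=> oB; rewrite openE => x Bx; apply/nbhs_box.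
have /nbhs_box[k kB] : nbhs (restr x) B by exact: open_nbhs_nbhs.
by exists k => y xy; apply: kB => -[nu i]; exact: (xy (fincl TT nu, i)).
Qed.

Definition borel_restr : borelQT T d -> borelQT T' d := restr.

Lemma restr_measurable : measurable_fun [set: borelQT T d] borel_restr.
Proof.
move=> _ B mB; rewrite setTI; move: B mB.
suff h : measurable `<=` [set B : set (borelQT T' d) | measurable (borel_restr @^-1` B)] by [].
apply: smallest_sub; last by move=> B oB; apply: open_measurable_QT; exact: restr_open.
split=> [|B mB|F mF] /=.
- by rewrite preimage_set0.
- by rewrite setTD preimage_setC; exact: measurableC.
- by rewrite preimage_bigcup; exact: bigcupT_measurable.
Qed.

Variables (mu : {measure set (borelQT T d) -> \bar R}) (mu' : {measure set (borelQT T' d) -> \bar R}).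
Hypothesis mu_translate : forall (A : set (borelQT T d)) (u : QT T d),
  measurable A -> mu (translate u @` A) = mu A.
Hypothesis mu_unit : mu (box (fun=> 0%N) (fun=> 0)) = 1%E.
Hypothesis mu'_translate : forall (A : set (borelQT T' d)) (u : QT T' d),
  measurable A -> mu' (translate u @` A) = mu' A.
Hypothesis mu'_unit : mu' (box (fun=> 0%N) (fun=> 0)) = 1%E.

Let o : QT T d := fun=> 0.
Let o' : QT T' d := fun=> 0.
Let b0 : set (borelQT T d) := box (fun=> 0%N) o.
Let b0' : set (borelQT T' d) := box (fun=> 0%N) o'.

Lemma vol_restr N : @vol R T d (fun c => if val c.1 \in T' then N else 0%N)
  = @vol R T' d (fun=> N).
Proof.
pose G (nu : prime_nat) : R := \prod_(i < d) (val nu)%:R ^- (if nu \in T' then N else 0%N).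
have volT (V : {fset prime_nat}) : (V `<=` T)%fset ->
    @vol R V d (fun c => if val c.1 \in T' then N else 0%N) = \prod_(nu <- V) G nu.
  move=> _; rewrite /vol big_seq_fsetE /= [RHS](eq_bigr (fun nu : V => G (val nu)))//.
  by rewrite /G pair_bigA.
rewrite volT// -(big_fset_incl _ TT); last first.
  move=> nu _ nuT'; rewrite /G (negPf nuT') big1// => i _.
  by rewrite expr0 invr1.
rewrite -volT//; congr vol; apply/funext => -[nu i] /=.
by rewrite (valP nu).
Qed.

Lemma restr_measurable_set (A : set (borelQT T' d)) : measurable A ->
  measurable (restr @^-1` A : set (borelQT T d)).
Proof. by move=> mA; have := restr_measurable measurableT mA; rewrite setTI. Qed.

(** This carries almost-everywhere statements about the other primes to all of [T]. The push-forward
    [m1] of [mu] on the unit cube is at most [m2], the measure [mu'] on the unit cube, for cubes and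
    hence for unions of cubes of one level; approximation by such unions extends this to null
    sets. *)
Lemma restr_null (A : set (QT T' d)) : mu'.-negligible A -> mu.-negligible (restr @^-1` A `&` b0).
Proof.
have mb0 : measurable b0 by exact: box_measurable.
have mb0' : measurable b0' by exact: box_measurable.
have [m1 m1E] : exists m1 : {measure set (borelQT T' d) -> \bar R},
    forall B, m1 B = mu (restr @^-1` B `&` b0).
  unshelve eexists; first refine (pushforward (mrestr mu mb0) borel_restr : {measure set (borelQT T' d) -> \bar R}).
    exact: restr_measurable.
  by move=> B.
pose m2 : {measure set (borelQT T' d) -> \bar R} := mrestr mu' mb0'.
have le12 N (C : set (QT T' d)) : invariant (fun=> N) C -> (m1 C <= m2 C)%E.
  move=> iC; have h x : (m1 (box (fun=> N) x) <= m2 (box (fun=> N) x))%E.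
    rewrite m1E; have [->|/set0P[y [xy y0]]] := eqVneq (restr @^-1` box (fun=> N) x `&` b0) set0.
      by rewrite measure0 measure_ge0.
    have -> : restr @^-1` box (fun=> N) x `&` b0 = box (fun c => if val c.1 \in T' then N else 0%N) y.
      apply/seteqP; split=> z.
        move=> [xz z0] [nu i] /=; case: ifP => nuT'; last exact: box_trans (box_sym y0) z0 (nu, i).
        have := box_trans (box_sym xy) xz ([` nuT']%fset, i).
        rewrite /restr /=; have e : fincl TT [` nuT']%fset = nu by exact: val_inj.
        have h (w : T) : w = nu -> lev N (z w 0 i - y w 0 i) -> lev N (z nu 0 i - y nu 0 i) by move=> ->.
        exact: h e.
      move=> yz; split.
        apply: box_trans xy _ => -[nu i]; have := yz (fincl TT nu, i).
        by rewrite /= (valP nu).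
      by apply: box_trans y0 _; apply: box_le yz => c.
    rewrite (mu_box mu_translate mu_unit) vol_restr /m2 /= /mrestr setIidl.
      by rewrite (mu_box mu'_translate mu'_unit).
    have xy' : box (fun=> 0%N) o' (restr y) by move=> -[nu i]; exact: (y0 (fincl TT nu, i)).
    move=> z xz; apply: box_trans xy' _; apply: box_trans (_ : box _ _ x) _.
      by apply: box_le (box_sym xy) => c.
    by apply: box_le xz => c.
  have e1 : m1 (C `&` b0') = m1 C.
    rewrite !m1E; congr (mu _); apply/seteqP; split=> z [zC z0]; first by split=> //; case: zC.
    by split=> //; split=> // -[nu i]; exact: (z0 (fincl TT nu, i)).
  have e2 : m2 (C `&` b0') = m2 C by rewrite /m2 /= /mrestr -setIA setIid.
  by rewrite -e1 -e2; exact: invariant_measure_le iC h.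
case=> A0 [mA0 A00 AA0]; exists (restr @^-1` A0 `&` b0); split; last by move=> x [/AA0].
  by apply: measurableI => //; exact: restr_measurable_set.
apply/eqP; rewrite -m1E eq_le measure_ge0 andbT; apply/lee_addgt0Pr => e e0.
(* Approximating for the sum of the two measures controls both symmetric differences at once. *)
have m12T : (measure_add m1 m2 setT < +oo)%E.
  rewrite measure_addE m1E preimage_setT setTI /b0 (mu_box mu_translate mu_unit).
  by rewrite /m2 /= /mrestr setTI /b0' (mu_box mu'_translate mu'_unit) -EFinD ltry.
have [N [C [iC]]] := measurable_approximable m12T mA0 e0.
rewrite -[X in (X < _)%E -> _]/(measure_add m1 m2 (A0 `+` C)) measure_addE => hC; have mC := invariant_measurable iC.
have mY : measurable (A0 `+` C) by exact: measurable_setY.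
rewrite add0e; apply: le_trans (ltW hC).
have -> : m1 A0 = (m1 (A0 `\` C) + m1 (A0 `&` C))%E by exact: measureDI.
have m2C : (m2 C <= m2 (A0 `+` C))%E.
  have -> : m2 C = (m2 (C `\` A0) + m2 (C `&` A0))%E by exact: measureDI.
  have -> : m2 (C `&` A0) = 0%E.
    apply: subset_measure0 A00; [|exact: mA0|by move=> x [[]]].
    by apply: measurableI => //; exact: measurableI.
  rewrite adde0; apply: le_measure; rewrite ?inE; [exact: measurableD|by []|].
  by move=> x h; right.
apply: leeD.
  by apply: le_measure; rewrite ?inE; [exact: measurableD|by []|move=> x h; left].
apply: le_trans m2C; apply: le_trans (le12 _ _ iC).
by apply: le_measure; rewrite ?inE; [exact: measurableI|by []|move=> x []].
Qed.

End Projection.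

(** * Differentiability and the pigeonhole principle *)

Lemma within_continuous_row p n m (A : set 'rV[padic p]_n) (g : 'rV[padic p]_n -> 'rV[padic p]_m)
    (x : 'rV[padic p]_n) M : {within A, continuous g} -> A x ->
  exists r, forall y : 'rV[padic p]_n, A y -> (forall i, lev r (y 0 i - x 0 i)) ->
    forall j, lev M (g y 0 j - g x 0 j).
Proof.
move=> /subspace_continuousP cg Ax.
have hB : nbhs (g x) [set z : 'rV[padic p]_m | forall j, lev M (z 0 j - g x 0 j)].
  by apply/nbhs_padic_row; exists M.
have /nbhs_padic_row[r rP] := cg _ Ax _ hB.
by exists r => y Ay xy; exact: rP.
Qed.

(** Go from [x] to [y] one coordinate at a time. Each step is an increment times a difference
    quotient, whose continuous extension has the partial derivative as its value at coinciding
    nodes. *)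
Lemma Ck_differentiable p m n (U : set 'rV[padic p]_n) (f : 'rV[padic p]_n -> 'rV[padic p]_m)
    k (x : 'rV[padic p]_n) : open U -> U x -> Ck k.+1 U f ->
  exists D : 'M[padic p]_(n, m), forall M, exists r, forall (y : 'rV[padic p]_n) rho,
    (r <= rho)%N -> (forall i, lev rho (y 0 i - x 0 i)) ->
    forall j, lev (rho + M) ((f y - f x - (y - x) *m D) 0 j).
Proof.
move=> oU Ux [_ /choice[g gP]].
pose w0 (i : 'I_n) : 'rV[padic p]_(n + 1) := row_mx x (const_mx (x 0 i)).
pose D : 'M[padic p]_(n, m) := \matrix_(i, j) g i (w0 i) 0 j.
exists D => M.
have /nbhs_padic_row[r0 r0U] : nbhs x U by exact: open_nbhs_nbhs.
have w0dom i : quot_dom U i (w0 i).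
  rewrite /quot_dom /w0 /= row_mxKl row_mxKr mxE; split=> //.
  by rewrite (_ : set_coord _ _ _ = x)//; apply/rowP => j; rewrite mxE; case: eqP => // ->.
have /choice[r rP] (i : 'I_n) : exists r, forall w, quot_dom U i w ->
    (forall l, lev r (w 0 l - w0 i 0 l)) -> forall j, lev M (g i w 0 j - g i (w0 i) 0 j).
  have [_ gk] := gP i.
  have {gk} : {within quot_dom U i, continuous (g i)} by case: (k) gk => [|k'] [].
  by move=> /within_continuous_row/(_ (w0dom i)).
exists (maxn r0 (\max_i r i)) => y rho rrho xy j.
have r0rho : (r0 <= rho)%N by apply: leq_trans rrho; exact: leq_maxl.
have rrho' i : (r i <= rho)%N.
  by apply: leq_trans rrho; apply: leq_trans (leq_maxr _ _); exact: leq_bigmax.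
pose z (k : nat) : 'rV[padic p]_n := \row_i (if (i < k)%N then y 0 i else x 0 i).
have zU k' : U (z k').
  apply: r0U => i; apply: lev_le r0rho _; rewrite mxE; case: ifP => // _.
  by rewrite subrr lev_zero.
have zS (i : 'I_n) : z i.+1 = set_coord (z i) i (y 0 i).
  apply/rowP => l; rewrite !mxE; have [->|li] := eqVneq l i; first by rewrite ltnSn.
  by rewrite ltnS leq_eqVlt val_eqE (negPf li).
pose w (i : 'I_n) : 'rV[padic p]_(n + 1) := row_mx (z i) (const_mx (y 0 i)).
have step (i : 'I_n) : f (z i.+1) - f (z i) = (y 0 i - x 0 i) *: g i (w i).
  have zi : z i 0 i = x 0 i by rewrite mxE ltnn.
  (* At coinciding nodes [is_quot] says nothing about [g], but then both sides vanish. *)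
  have [yx|yx] := eqVneq (y 0 i) (x 0 i).
    rewrite yx subrr scale0r zS yx -zi (_ : set_coord _ _ _ = z i) ?subrr//.
    by apply/rowP => l; rewrite mxE; case: eqP => // ->.
  have [gq _] := gP i; have := gq (w i); rewrite /quot_dom /w /= row_mxKl row_mxKr mxE.
  rewrite -zS zi => /(_ (conj (zU _) (zU _)) yx) ->.
  rewrite scalerA -(opprB (x 0 i) (y 0 i)) mulNr mulfV ?scaleN1r ?opprB// subr_eq0 eq_sym//.
have -> : f y - f x = \sum_(i < n) (y 0 i - x 0 i) *: g i (w i).
  have zn : z n = y by apply/rowP => i; rewrite mxE ltn_ord.
  have z0 : z 0%N = x by apply/rowP => i; rewrite mxE.
  have -> : f y - f x = f (z n) - f (z 0%N) by rewrite zn z0.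
  rewrite -(telescope_sumr (fun k => f (z k))) ?leq0n// big_mkord.
  by apply: eq_bigr => i _; rewrite step.
have -> : (y - x) *m D = \sum_(i < n) (y 0 i - x 0 i) *: g i (w0 i).
  by apply/rowP => l; rewrite mxE summxE; apply: eq_bigr => i _; rewrite !mxE.
rewrite -sumrB summxE; apply: lev_sum => i _; rewrite -scalerBr mxE; apply: levM => //.
rewrite !mxE; apply: rP.
  by rewrite /quot_dom /w /= row_mxKl row_mxKr mxE -zS.
move=> l; apply: lev_le (rrho' i) _; rewrite /w /w0 !mxE.
case: splitP => l' _; rewrite !mxE//; case: ifP => // _.
by rewrite subrr lev_zero.
Qed.

(** Vectors with entries in [[0, H]] outnumber the residue classes of the values of the forms;
    subtract two vectors with the same classes. *)
Lemma pigeonhole_forms (I : finType) (p : I -> prime_nat) (n H : nat) (a : I -> nat)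
    (L : forall i : I, 'rV[int]_n.+1 -> padic (p i)) :
  (forall i b c, L i (b - c) = L i b - L i c) ->
  (forall i b, lev 0 (L i b)) ->
  (\prod_i (val (p i)) ^ a i < H.+1 ^ n.+1)%N ->
  exists b : 'rV[int]_n.+1, [/\ b != 0, forall j, (`|b ord0 j| <= H)%N & forall i, lev (a i) (L i b)].
Proof.
move=> LB L0 lt.
have ap i : (0 < val (p i) ^ a i)%N by rewrite expn_gt0 (ltn_trans _ (pint_p_gt1 _)).
pose v (h : {ffun 'I_n.+1 -> 'I_H.+1}) : 'rV[int]_n.+1 := \row_j (h j : nat)%:Z.
have /choice[c cP] (ih : I * {ffun 'I_n.+1 -> 'I_H.+1}) :
    exists c : nat, (c < val (p ih.1) ^ a ih.1)%N /\ lev (a ih.1) (L ih.1 (v ih.2) - c%:R).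
  by have [c] := lev_approx (a ih.1) (L0 ih.1 (v ih.2)); exists c.
pose phi (h : {ffun 'I_n.+1 -> 'I_H.+1}) : {dffun forall i : I, 'I_(val (p i) ^ a i)} :=
  [ffun i => Ordinal (cP (i, h)).1].
have : ~ injective phi.
  move=> /leq_card; rewrite card_ffun !card_ord card_dep_ffun foldrE big_map big_enum /=.
  by rewrite (eq_bigr _ (fun i _ => card_ord _)) leqNgt lt.
move=> ninj; have /injectivePn[h [h' hh' e]] : ~~ injectiveb phi by apply/negP => /injectiveP.
exists (v h - v h'); split.
- apply: contra hh' => /eqP /rowP hE; apply/eqP/ffunP => j; apply: val_inj => /=.
  by have := hE j; rewrite !mxE => /eqP; rewrite subr_eq0 => /eqP [].
- move=> j; rewrite !mxE; move: (ltn_ord (h j)) (ltn_ord (h' j)).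
  by move: (nat_of_ord (h j)) (nat_of_ord (h' j)) => u w; lia.
- move=> i; rewrite LB; have := congr1 (fun F : {dffun forall i : I, 'I_(val (p i) ^ a i)} => val (F i)) e; rewrite !ffunE /= => ce.
  have [_ h1] := cP (i, h); have [_ h2] := cP (i, h').
  by have := levB h1 h2; rewrite /= ce opprB addrA subrK.
Qed.

(** * Real levels and heights *)

Section Levels.
Variable R : realType.

Lemma prime_natR_gt1 (p : prime_nat) : 1 < (val p)%:R :> R.
Proof. by rewrite ltr1n pint_p_gt1. Qed.

Lemma lvl_ex (p : prime_nat) (X : R) : exists e, X < (val p)%:R ^+ e.
Proof.
have e0 : 0 < (Num.max X 1)^-1 by rewrite invr_gt0 lt_max ltr01 orbT.
have [k] := natinv_lt (pint_p_gt1 p) e0.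
rewrite ltf_pV2 ?posrE ?exprn_gt0 ?padic_pos//; last by rewrite lt_max ltr01 orbT.
by move=> h; exists k; apply: le_lt_trans h; rewrite le_max lexx.
Qed.

(** The strict inequality in [lvl_ex] yields the strict one in [W]; minimality keeps the rounding
    loss within a factor [p]. *)
Definition lvl p X := ex_minn (lvl_ex p X).

Lemma lvl_gt p X : X < (val p)%:R ^+ lvl p X.
Proof. by rewrite /lvl; case: ex_minnP. Qed.

Lemma lvl_min p X k : X < (val p)%:R ^+ k -> (lvl p X <= k)%N.
Proof. by rewrite /lvl; case: ex_minnP => e _ h /h. Qed.

Lemma lvl_le p X : 1 <= X -> (val p)%:R ^+ lvl p X <= (val p)%:R * X.
Proof.
move=> X1; have := lvl_gt p X; case E : (lvl p X) => [|e].
  by rewrite expr0 ltNge X1.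
move=> _; rewrite exprS ler_pM2l ?padic_pos// leNgt; apply/negP => /lvl_min.
by rewrite E ltnn.
Qed.

Lemma lvl_mono p X Y : X <= Y -> (lvl p X <= lvl p Y)%N.
Proof. by move=> XY; apply: lvl_min; apply: le_lt_trans XY (lvl_gt _ _). Qed.

Lemma powR_large (t C : R) : 0 < t -> \forall H \near \oo, C < H%:R `^ t.
Proof.
move=> t0; pose M := Num.max C 1; have M0 : 0 < M by rewrite lt_max ltr01 orbT.
exists (Num.truncn (M `^ t^-1)).+1 => // H /= hH.
apply: (@le_lt_trans _ _ M); first by rewrite le_max lexx.
have -> : M = (M `^ t^-1) `^ t by rewrite -powRrM mulVf ?gt_eqF// powRr1// ltW.
rewrite gt0_ltr_powR// ?nnegrE ?powR_ge0//.
by apply: lt_le_trans (truncnS_gt _) _; rewrite ler_nat.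
Qed.

Lemma lvl_large p (kap : nat) (t : R) C : (0 < kap)%N -> 0 < t ->
  \forall H \near \oo, (C <= lvl p (kap%:R * H%:R `^ t))%N.
Proof.
move=> k0 t0; near=> H.
have : (val p)%:R ^+ C < (val p)%:R ^+ lvl p (kap%:R * H%:R `^ t) :> R.
  apply: lt_trans (lvl_gt _ _); apply: (@lt_le_trans _ _ (H%:R `^ t)).
    by near: H; exact: powR_large.
  by rewrite ler_peMl ?powR_ge0// ler1n.
by rewrite ltr_eXn2l ?prime_natR_gt1//; exact: ltnW.
Unshelve. all: by end_near. Qed.

End Levels.

Lemma lev_eq0 p (z : padic p) : (forall k, lev k z) -> z = 0.
Proof.
move=> h; apply/eqP; rewrite -(padic_abs_eq0 rat) eq_le padic_abs_ge0 andbT leNgt.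
apply/negP => z0; have [k] := natinv_lt (pint_p_gt1 p) z0.
by rewrite ltNge => /negP; apply; exact: h.
Qed.

Lemma not_near_infty (P : nat -> Prop) : ~ (\forall H \near \oo, P H) ->
  forall H0, exists2 H, (H0 <= H)%N & ~ P H.
Proof.
move=> nP H0; apply: contrapT => h; apply: nP; exists H0 => // H /= hH.
by apply: contrapT => nPH; apply: h; exists H.
Qed.

Lemma int_row_scale_eq0 n (a : int) (b : 'rV[int]_n) : (a *: b == 0) = (a == 0) || (b == 0).
Proof.
apply/eqP/orP => [h|[/eqP ->|/eqP ->]]; rewrite ?scale0r ?scaler0//.
have [|a0] := eqVneq a 0; first by left.
right; apply/eqP/rowP => j; have /rowP/(_ j) := h; rewrite !mxE => /eqP.
by rewrite mulf_eq0 (negPf a0) => /eqP.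
Qed.

(* If X were finite, one of its elements would solve the system exactly, and then
   so would its multiples. *)
Lemma infinite_approx (T : {fset prime_nat}) n (y : QT T n) (X : set 'rV[int]_n.+1)
    (e : 'I_n -> T -> nat -> nat) :
  (forall i nu C, \forall H \near \oo, (C <= e i nu H)%N) ->
  (forall b : 'rV[int]_n.+1, b != 0 ->
    (forall i (nu : T), (b ord0 ord0)%:~R * y nu 0 i - (b ord0 (lift ord0 i))%:~R = 0) -> X b) ->
  (forall H0, exists H, exists b : 'rV[int]_n.+1, [/\ (H0 <= H)%N, b != 0, X b &
    forall i (nu : T), lev (e i nu H) ((b ord0 ord0)%:~R * y nu 0 i - (b ord0 (lift ord0 i))%:~R)]) ->
  infinite_set X.
Proof.
move=> e_large Xex Xap finX.
pose z (b : 'rV[int]_n.+1) i (nu : T) := (b ord0 ord0)%:~R * y nu 0 i - (b ord0 (lift ord0 i))%:~R.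
have [[b [b0 bex]]|nex] := pselect (exists b, b != 0 /\ forall i nu, z b i nu = 0).
  have : finite_set ((fun t : nat => t.+1%:Z *: b) @^-1` X).
    apply: finite_preimage finX => t u _ _ /eqP.
    rewrite -subr_eq0 -scalerBl int_row_scale_eq0 (negPf b0) orbF subr_eq0 => /eqP [].
    by [].
  rewrite (_ : _ @^-1` X = setT) => [/infinite_nat//|].
  apply/seteqP; split=> // t _ /=; apply: Xex; first by rewrite int_row_scale_eq0 (negPf b0) orbF.
  move=> i nu; have := bex i nu; rewrite /z => h.
  by rewrite !mxE !intrM -mulrA -mulrBr h mulr0.
have /finite_fsetP[A AX] := finX.
have : \forall H \near \oo, forall b : A, val b != 0 -> ~ forall i nu, lev (e i nu H) (z (val b) i nu).
  apply: filter_forall => b; have [b0|b0] := eqVneq (val b) 0; first by apply: nearW.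
  have [i [nu /eqP znz]] : exists i nu, z (val b) i nu <> 0.
    apply: contrapT => h; apply: nex; exists (val b); split=> // i nu.
    by apply: contrapT => h2; apply: h; exists i, nu.
  have [k nk] : exists k, ~ lev k (z (val b) i nu).
    apply: contrapT => h; move/eqP: znz; apply; apply: lev_eq0 => k.
    by apply: contrapT => h2; apply: h; exists k.
  near=> H; move=> _ /(_ i nu) h; apply: nk; apply: lev_le h.
  by near: H; exact: e_large.
move=> [H0 _ hH0]; have [H [b [HH b0 Xb hb]]] := Xap H0.
have bA : b \in A by move: Xb; rewrite AX.
exact: (hH0 H HH [` bA]%fset b0).
Unshelve. all: by end_near. Qed.

Lemma height_gt0 n (b : 'rV[int]_n.+1) : b != 0 -> (0 < height b)%N.
Proof.
move=> b0; rewrite lt0n; apply: contra b0 => /eqP h; apply/eqP/rowP => j.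
have : (`|b ord0 j| <= height b)%N by apply: (@leq_bigmax _ (fun j => `|b ord0 j|%N)).
by rewrite h leqn0 absz_eq0 !mxE => /eqP.
Qed.

Lemma prod_primes_dvd (r : seq prime_nat) (k : prime_nat -> nat) (M : nat) : uniq r ->
  (forall nu, nu \in r -> (val nu ^ k nu %| M)%N) -> (\prod_(nu <- r) val nu ^ k nu %| M)%N.
Proof.
elim: r => [|nu r IH /= /andP[nur ur] h]; first by rewrite big_nil dvd1n.
rewrite big_cons Gauss_dvd; first by rewrite h ?mem_head//= IH// => s sr; apply: h; rewrite in_cons sr orbT.
rewrite coprime_sym; elim: r nur {IH ur h} => [|s r IH]; first by rewrite big_nil coprime1n.
rewrite in_cons negb_or => /andP[nus nur]; rewrite big_cons coprimeMl IH// andbT.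
rewrite coprimeXl// coprimeXr// prime_coprime ?(valP s)// dvdn_prime2 ?(valP s) ?(valP nu)//.
by rewrite eq_sym.
Qed.

(** * Approximation at a point *)

Section Weights.
Variables (R : realType) (S : {fset prime_nat}) (d m : nat).
Variables (tau : 'I_(d + m) -> prime_nat -> R) (kap : nat).
Hypothesis kap_gt0 : (0 < kap)%N.
Hypothesis S_neq0 : S != fset0.
Hypothesis tau_gt0 : forall i nu, nu \in S -> 0 < tau i nu.
Hypothesis tau_sum : \sum_(i < d + m) \sum_(nu <- S) tau i nu = (d + m).+1%:R.
Hypothesis tau_le : forall nu, nu \in S -> forall i j, tau (rshift d j) nu <= tau (lshift m i) nu.
Hypothesis tau_share : forall nu, nu \in S -> forall j, weight_share tau nu < tau j nu.
Hypothesis d_gt0 : (0 < d)%N.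

(** Having this level means being smaller than [kap^-1 H^(-tau i nu)]. *)
Definition elev (i : 'I_(d + m)) (nu : prime_nat) H := lvl nu (kap%:R * H%:R `^ tau i nu).

Let kapR : 1 <= kap%:R :> R. Proof. by rewrite ler1n. Qed.

Lemma powR_nat_ge1 (H : nat) (t : R) : (0 < H)%N -> 0 <= t -> 1 <= H%:R `^ t.
Proof. by move=> H0 t0; apply: le_trans (ler_powR _ t0); rewrite ?powRr0// ler1n. Qed.

Lemma elev_ge i nu H : H%:R `^ tau i nu <= (val nu)%:R ^+ elev i nu H.
Proof. by apply: le_trans (ltW (lvl_gt _ _)); rewrite ler_peMl ?powR_ge0. Qed.

Lemma elev_le i nu H : (0 < H)%N -> nu \in S ->
  (val nu)%:R ^+ elev i nu H <= (val nu)%:R * kap%:R * H%:R `^ tau i nu.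
Proof.
move=> H0 nuS; rewrite -mulrA lvl_le// -[leLHS]mulr1 ler_pM//.
by rewrite powR_nat_ge1// ltW// tau_gt0.
Qed.

Lemma elev_mono i j nu H : (0 < H)%N -> tau i nu <= tau j nu -> (elev i nu H <= elev j nu H)%N.
Proof.
by move=> H0 ij; apply: lvl_mono; rewrite ler_wpM2l// ?(le_trans ler01)// ler_powR// ler1n.
Qed.

Lemma elev_large i nu C : nu \in S -> \forall H \near \oo, (C <= elev i nu H)%N.
Proof. by move=> nuS; apply: lvl_large => //; exact: tau_gt0. Qed.

(** The shares sum to exactly 1 over [S], and each weight exceeds the share of its prime. *)
Lemma sum_tau_gt1 i : 1 < \sum_(nu : S) tau i (val nu).
Proof.
have -> : 1 = \sum_(nu : S) weight_share tau (val nu) :> R.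
  rewrite -mulr_sumr exchange_big /=.
  rewrite (eq_bigr (fun i => \sum_(nu <- S) tau i nu)) => [|j _]; last by rewrite big_seq_fsetE.
  by rewrite tau_sum mulVf// pnatr_eq0.
apply: ltr_sum => [|nu _]; last by rewrite tau_share// (valP nu).
have /fset0Pn[nu nuS] := S_neq0.
by apply/hasP; exists [` nuS]%fset => //; rewrite mem_index_enum.
Qed.

Lemma prod_powR (I : Type) (r : seq I) (P : pred I) (H : nat) (t : I -> R) : (0 < H)%N ->
  \prod_(i <- r | P i) (H%:R `^ t i) = H%:R `^ (\sum_(i <- r | P i) t i).
Proof.
move=> H0; rewrite (big_morph (fun t => H%:R `^ t) (id1 := 1) (op1 := *%R))//.
  by move=> u v; rewrite powRD// pnatr_eq0 -lt0n H0 implybT.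
by rewrite powRr0.
Qed.

Section Point.
Variables (x : QT S d) (fx : QT S m) (D : forall nu : S, 'M[padic (val nu)]_(d, m)) (N : nat).
Hypothesis x_int : forall (nu : S) i, lev 0 (x nu 0 i).
Hypothesis fx_int : forall (nu : S) j, lev 0 (fx nu 0 j).
Hypothesis D_bounded : forall (nu : S) i j, lev 0 ((val (val nu) ^ N)%N%:R * D nu i j).

Let y : QT S (d + m) := fun nu => row_mx (x nu) (fx nu).

Definition approx T n (y : QT T n) (b : 'rV[int]_n.+1) (nu : T) (i : 'I_n) : padic (val nu) :=
  (b ord0 ord0)%:~R * y nu 0 i - (b ord0 (lift ord0 i))%:~R.

Lemma approxB T n (y' : QT T n) b c nu i : approx y' (b - c) nu i = approx y' b nu i - approx y' c nu i.
Proof. by rewrite /approx !mxE !intrB; ring. Qed.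

Lemma approxZ T n (y' : QT T n) (a : int) b nu i : approx y' (a *: b) nu i = a%:~R * approx y' b nu i.
Proof. by rewrite /approx !mxE !intrM; ring. Qed.

Lemma y_int (nu : S) i : lev 0 (y nu 0 i).
Proof. by rewrite /y mxE; case: splitP => j _; [exact: x_int|exact: fx_int]. Qed.

Lemma approx_int b (nu : S) i : lev 0 (approx y b nu i).
Proof. by apply: levB; [apply: levMr; [exact: lev_int0|exact: y_int]|exact: lev_int0]. Qed.

(* The approximation of the dependent coordinate at the rational point of the
   tangent space above (b_1, ..., b_d) / b_0. *)
Definition tangent_form b (nu : S) (j : 'I_m) : padic (val nu) :=
  approx y b nu (rshift d j) - \sum_(i < d) approx y b nu (lshift m i) * D nu i j.

Lemma tangent_formB b c nu j : tangent_form (b - c) nu j = tangent_form b nu j - tangent_form c nu j.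
Proof.
rewrite /tangent_form approxB.
have -> : \sum_i approx y (b - c) nu (lshift m i) * D nu i j =
    \sum_i approx y b nu (lshift m i) * D nu i j - \sum_i approx y c nu (lshift m i) * D nu i j.
  by rewrite -sumrB; apply: eq_bigr => i _; rewrite approxB mulrBl.
by ring.
Qed.

(** The deficit of the count at a prime [p]: rounding costs [p^(d + m)], the factor [kap] costs
    [kap^(d + m) <= p^(kap (d + m))], and clearing the denominators of [D] costs [p^(m N)]. Giving
    up [s] levels in a single independent coordinate already covers it. *)
Let s := ((d + m) * (1 + kap) + m * N)%N.

Definition sol H (b : 'rV[int]_(d + m).+1) := [/\ b != 0, forall j, (`|b ord0 j| <= H)%N,
  forall (nu : S) i, lev (elev (lshift m i) (val nu) H - s) (approx y b nu (lshift m i)) &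
  forall (nu : S) j, lev (elev (rshift d j) (val nu) H) (tangent_form b nu j)].

Lemma sol_ex : \forall H \near \oo, exists b, sol H b.
Proof.
near=> H; have H0 : (0 < H)%N by near: H; exact: nbhs_infty_ge.
have se (nu : S) i : (s <= elev i (val nu) H)%N.
  move: nu i; near: H; apply: filter_forall => nu; apply: filter_forall => i.
  by apply: elev_large; exact: (valP nu).
(* The factor [p^N] makes the tangent forms integral, as the pigeonhole requires; their levels are
   raised by [N] in exchange. *)
pose form (c : S * 'I_(d + m)) b : padic (val c.1) :=
  if fintype.split c.2 is inr j then (val (val c.1) ^ N)%N%:R * tangent_form b c.1 j
  else approx y b c.1 c.2.
pose a (c : S * 'I_(d + m)) := if fintype.split c.2 is inr j then (elev c.2 (val c.1) H + N)%N
  else (elev c.2 (val c.1) H - s)%N.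
have formB c b b' : form c (b - b') = form c b - form c b'.
  by rewrite /form; case: (fintype.split c.2) => j; rewrite ?approxB// tangent_formB mulrBr.
have form_int c b : lev 0 (form c b).
  rewrite /form; case: (fintype.split c.2) => j; first exact: approx_int.
  rewrite /tangent_form mulrBr; apply: levB; first by apply: levMr; [exact: lev_nat0|exact: approx_int].
  rewrite mulr_sumr; apply: lev_sum => i _; rewrite mulrCA.
  by apply: levMr; [exact: approx_int|exact: D_bounded].
have count : (\prod_c val (val c.1) ^ a c < H.+1 ^ (d + m).+1)%N.
  apply: (@leq_ltn_trans (H ^ (d + m).+1)); last by rewrite ltn_exp2r.
  rewrite -(ler_nat R) natr_prod natrX.
  pose v (c : S * 'I_(d + m)) : R := (val (val c.1))%:R * kap%:R *
    (if fintype.split c.2 is inr j then (val (val c.1))%:R ^+ N else (val (val c.1))%:R ^- s).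
  have v_ge0 c : 0 <= v c by rewrite /v !mulr_ge0//; case: (fintype.split c.2) => // j; rewrite ?invr_ge0 exprn_ge0.
  apply: (@le_trans _ _ (\prod_c (v c * H%:R `^ tau c.2 (val c.1)))).
    apply: ler_prod => c _; rewrite natrX exprn_ge0//= /a /v.
    have := elev_le c.2 H0 (valP c.1); case: (fintype.split c.2) => j h; last first.
      by rewrite exprD mulrAC ler_wpM2r ?exprn_ge0.
    by rewrite mulrAC ler_pdivlMr ?exprn_gt0 ?padic_pos// -exprD subnK.
  rewrite big_split /= prod_powR// -[leRHS]mul1r ler_pM ?prodr_ge0 ?powR_ge0//; last first.
    rewrite (_ : \sum_c _ = (d + m).+1%:R) ?powR_mulrn//.
    rewrite -tau_sum exchange_big /= big_seq_fsetE /= pair_bigA //=.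
  rewrite (_ : \prod_c v c = \prod_(nu : S) \prod_(i < d + m) v (nu, i)); last first.
    by rewrite pair_bigA; apply: eq_bigr => -[].
  apply: (@le_trans _ _ (\prod_(nu : S) 1)); last by rewrite big1.
  apply: ler_prod => nu _; rewrite prodr_ge0//=.
  rewrite big_split_ord /=.
  rewrite (eq_bigr (fun=> (val (val nu))%:R * kap%:R * (val (val nu))%:R ^- s)) => [|i _]; last first.
    by rewrite /v /= (unsplitK (inl i)).
  rewrite [X in _ * X](eq_bigr (fun=> (val (val nu))%:R * kap%:R * (val (val nu))%:R ^+ N)) => [|i _]; last first.
    by rewrite /v /= (unsplitK (inr i)).
  set p := val (val nu); have p0 k : 0 < p%:R ^+ k :> R by rewrite exprn_gt0// padic_pos.
  rewrite !prodr_const !card_ord.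
  rewrite [leLHS](_ : _ = ((p * kap) ^ (d + m) * p ^ (N * m))%N%:R / (p ^ (s * d))%N%:R); last first.
    by rewrite !natrM !natrX !natrM exprD !exprMn exprVn -!exprM; ring.
  rewrite ler_pdivrMr ?mul1r ?ler_nat ?ltr0n ?expn_gt0 ?(ltn_trans _ (pint_p_gt1 _))// expnMn.
  have kp : (kap ^ (d + m) <= p ^ (kap * (d + m)))%N.
    by rewrite expnM leq_exp2r ?addn_gt0 ?d_gt0// ltnW// ltn_expl// pint_p_gt1.
  apply: (@leq_trans (p ^ (d + m) * p ^ (kap * (d + m)) * p ^ (N * m))).
    by rewrite leq_mul2r leq_mul2l kp !orbT.
  rewrite -!expnD leq_exp2l ?pint_p_gt1// (leq_trans _ (leq_pmulr _ d_gt0))// /s.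
  by apply: eq_leq; ring.
have [b [b0 bH bl]] := pigeonhole_forms formB form_int count.
exists b; split=> // nu j.
  by have := bl (nu, lshift m j); rewrite /form /a /= (unsplitK (inl j)).
have := bl (nu, rshift d j); rewrite /form /a /= (unsplitK (inr j)).
by rewrite addnC lev_pM.
Unshelve. all: by end_near. Qed.

Lemma levM_bounded p k M (u v : padic p) : (M <= k)%N -> lev k u ->
  lev 0 ((val p ^ M)%N%:R * v) -> lev (k - M) (u * v).
Proof.
move=> Mk hu hv; rewrite -(@lev_pM _ M) subnKC// mulrCA -[k]addn0.
exact: levM.
Qed.

Lemma elev_large_all C : \forall H \near \oo, forall (nu : S) i, (C <= elev i (val nu) H)%N.
Proof.
apply: filter_forall => nu; apply: filter_forall => i.
by apply: elev_large; exact: (valP nu).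
Qed.

(** A dependent coordinate is its tangent form plus independent ones times entries of [D]. By
    [tau_le] the latter are fine enough, up to the [N] levels lost to denominators. *)
Lemma sol_approx : \forall H \near \oo, forall b, sol H b ->
  forall (nu : S) i, lev (elev i (val nu) H - (s + N)) (approx y b nu i).
Proof.
near=> H; have H0 : (0 < H)%N by near: H; exact: nbhs_infty_ge.
have sNe : forall (nu : S) i, (s + N <= elev i (val nu) H)%N by near: H; exact: elev_large_all.
move=> b [_ _ hx ht] nu i; rewrite -(splitK i).
case: (fintype.split i) => j /=; first by apply: lev_le (hx nu j); rewrite leq_sub2l// leq_addr.
rewrite -[approx _ _ _ _](subrK (\sum_(i < d) approx y b nu (lshift m i) * D nu i j)).
apply: levD; first by apply: lev_le (ht nu j); exact: leq_subr.
apply: lev_sum => l _; apply: (@lev_le _ _ (elev (lshift m l) (val nu) H - s - N)).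
  by rewrite subnDA !leq_sub2r// elev_mono// tau_le// (valP nu).
apply: levM_bounded; [|exact: hx|exact: D_bounded].
by rewrite leq_subRL ?sNe// (leq_trans _ (sNe nu _))// leq_addr.
Unshelve. all: by end_near. Qed.

(** If [b_0 = 0], each [b_i] is divisible by prime powers whose product is, up to a constant, at
    least [H] to the power [sum_nu tau i nu > 1]. This exceeds [H], so [b = 0]. *)
Lemma sol_b0 : \forall H \near \oo, forall b, sol H b -> b ord0 ord0 != 0.
Proof.
pose Q : R := \prod_(nu : S) (val (val nu))%:R ^+ (s + N).
near=> H; have H0 : (0 < H)%N by near: H; exact: nbhs_infty_ge.
have sNe : forall (nu : S) i, (s + N <= elev i (val nu) H)%N by near: H; exact: elev_large_all.
have HQ : forall i, Q < H%:R `^ (\sum_(nu : S) tau i (val nu) - 1).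
  near: H; apply: filter_forall => i; apply: powR_large.
  by rewrite subr_gt0 sum_tau_gt1.
have happ : forall b, sol H b ->
    forall (nu : S) i, lev (elev i (val nu) H - (s + N)) (approx y b nu i).
  by near: H; exact: sol_approx.
move=> b hb; have [b0 bH _ _] := hb; apply: contra b0 => /eqP b00; apply/eqP/rowP => k.
rewrite mxE; have [->|] := eqVneq k ord0; first exact: b00.
rewrite eq_sym => /unlift_some[i -> _]; apply: contrapT => /eqP bi.
have dv : (\prod_(nu <- S) val nu ^ (elev i nu H - (s + N)) %| `|b ord0 (lift ord0 i)|)%N.
  apply: prod_primes_dvd => [|nu nuS]; first exact: fset_uniq.
  have := happ b hb [` nuS]%fset i.
  by rewrite /approx b00 mul0r sub0r levN lev_int dvdzE absz_nat.
have := leq_trans (dvdn_leq _ dv) (bH _); rewrite absz_gt0 bi => /(_ isT).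
rewrite -(ler_nat R) natr_prod big_seq_fsetE /= leNgt => /negP; apply.
have Q0 : 0 < Q by apply: prodr_gt0 => nu _; rewrite exprn_gt0// padic_pos.
have -> : \prod_(nu : S) ((val (val nu) ^ (elev i (val nu) H - (s + N)))%:R : R) =
    (\prod_(nu : S) (val (val nu))%:R ^+ elev i (val nu) H) / Q.
  rewrite -prodf_div; apply: eq_bigr => nu _; rewrite natrX -[in RHS](subnK (sNe nu i)) exprD.
  by rewrite mulfK// gt_eqF// exprn_gt0// padic_pos.
rewrite ltr_pdivlMr//; apply: (@lt_le_trans _ _ (\prod_(nu : S) H%:R `^ tau i (val nu))); last first.
  by apply: ler_prod => nu _; rewrite powR_ge0 elev_ge.
rewrite prod_powR// -[X in _ `^ X](subrK 1) powRD; last by rewrite pnatr_eq0 -lt0n H0 implybT.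
by rewrite powRr1// mulrC ltr_pM2r ?ltr0n.
Unshelve. all: by end_near. Qed.

(** Translates between [b_0 y_i - b_i] in [W] and [b_0 y_i + b_i] in [exponent]. *)
Definition flip n (b : 'rV[int]_n.+1) : 'rV[int]_n.+1 :=
  \row_k (if k == ord0 then b ord0 k else - b ord0 k).

Lemma flipK n : involutive (@flip n).
Proof. by move=> b; apply/rowP => k; rewrite !mxE; case: (k == ord0); rewrite ?opprK. Qed.

Lemma height_flip n (b : 'rV[int]_n.+1) : height (flip b) = height b.
Proof. by apply: eq_bigr => k _; rewrite mxE; case: ifP => // _; rewrite abszN. Qed.

Definition exponent_set T n (kappa : 'I_n -> prime_nat -> R) (y' : QT T n) (w : R) :=
  [set b : 'rV[int]_n.+1 |
      \big[Num.max/0]_(i < n) \big[Num.max/0]_(nu : T)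
        (padic_abs R ((b 0 ord0)%:~R * y' nu 0 i + (b 0 (lift ord0 i))%:~R)
          `^ (kappa i (val nu))^-1)
      <= (height b)%:R `^ (- w)].

Lemma exponent_set_flip T n (kappa : 'I_n -> prime_nat -> R) (y' : QT T n) (w : R) b :
  (forall i nu, padic_abs R (approx y' b nu i) `^ (kappa i (val nu))^-1 <= (height b)%:R `^ (- w)) ->
  exponent_set kappa y' w (flip b).
Proof.
move=> h; rewrite /exponent_set /= height_flip.
apply: bigmax_le => [|i _]; first exact: powR_ge0.
apply: bigmax_le => [|nu _]; first exact: powR_ge0.
by have := h i nu; rewrite /approx !mxE /= intrN.
Qed.

Definition drop_prime (nu : prime_nat) : QT (S `\ nu)%fset (d + m) := restr (fsubD1set S nu) y.

Arguments drop_prime : clear implicits.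

Hypothesis exponent_small : forall nu, nu \in S -> forall i,
  (forall j, tau i nu <= tau j nu) -> tau i nu <= 1 ->
  exists w, [/\ 0 <= w, w * (1 - tau i nu) < 1 - weight_share tau nu &
    finite_set (exponent_set (weight_drop tau nu) (drop_prime nu) w)].

(* Otherwise dividing b by a large power of nu gives approximations of the other
   primes that are too good. *)
Lemma sol_valuation C : \forall H \near \oo, forall b, sol H b ->
  forall (nu : S) i j, lev j ((b ord0 ord0)%:~R : padic (val nu)) -> (j + C <= elev i (val nu) H)%N.
Proof.
suff h (nu : S) : exists2 i0, (forall i, tau i0 (val nu) <= tau i (val nu)) &
    \forall H \near \oo, forall b, sol H b -> forall j,
      lev j ((b ord0 ord0)%:~R : padic (val nu)) -> (j + C <= elev i0 (val nu) H)%N.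
  near=> H; have H0 : (0 < H)%N by near: H; exact: nbhs_infty_ge.
  have hH : forall nu : S, forall b, sol H b -> forall i j,
      lev j ((b ord0 ord0)%:~R : padic (val nu)) -> (j + C <= elev i (val nu) H)%N.
    near: H; apply: filter_forall => nu; have [i0 i0P hi0] := h nu.
    near=> H => b hb i j hj; apply: (@leq_trans (elev i0 (val nu) H)).
      by move: b hb j hj; near: H; exact: hi0.
    by apply: elev_mono => //; near: H; exact: nbhs_infty_ge.
  by move=> b hb nu i j; exact: hH.
pose i1 : 'I_(d + m) := lshift m (Ordinal d_gt0).
have [i0 _ i0P] := @arg_minP _ _ _ i1 xpredT (fun i => tau i (val nu)) isT.
have {}i0P i : tau i0 (val nu) <= tau i (val nu) by exact: i0P.
exists i0 => //; have nuS := valP nu; have t0 : 0 < tau i0 (val nu) by exact: tau_gt0.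
(* If the least weight exceeds 1, the bound [p^j <= |b_0| <= H] suffices. *)
have [gt1|le1] := ltP 1 (tau i0 (val nu)).
  near=> H => b hb j hj; have H0 : (0 < H)%N by near: H; exact: nbhs_infty_ge.
  have bn0 : b ord0 ord0 != 0 by move: b hb {hj}; near: H; exact: sol_b0.
  have big : ((val (val nu)) ^ C)%:R < H%:R `^ (tau i0 (val nu) - 1) :> R.
    by near: H; apply: powR_large; rewrite subr_gt0.
  have [_ bH _ _] := hb; have jH : (val (val nu) ^ j <= H)%N.
    by apply: leq_trans (bH ord0); move: hj; rewrite lev_int dvdzE absz_nat; apply: dvdn_leq; rewrite absz_gt0.
  rewrite ltnW// -(ltr_eXn2l (prime_natR_gt1 R (val nu))).
  apply: lt_le_trans (elev_ge _ _ _); rewrite exprD -!natrX.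
  apply: (@le_lt_trans _ _ (H%:R * ((val (val nu)) ^ C)%:R)); first by rewrite ler_wpM2r// ler_nat.
  rewrite -[X in _ `^ X](subrK 1) powRD; last by rewrite pnatr_eq0 -lt0n H0 implybT.
  by rewrite powRr1// mulrC ltr_pM2r ?ltr0n.
have [w [w0 wlt finX]] := exponent_small nuS i0P le1.
apply: contrapT => /not_near_infty nH.
have share_lt : 0 < 1 - weight_share tau (val nu).
  by rewrite subr_gt0 (lt_le_trans (tau_share nuS i0)).
set T := (S `\ val nu)%fset in finX *; set kappa := weight_drop tau (val nu) in finX *.
have TS (sg : T) : val sg \in S by have := valP sg; rewrite !inE => /andP[].
have TSn (sg : T) : val sg != val nu by have := valP sg; rewrite !inE => /andP[].
have kappaE i (sg : T) : (kappa i (val sg))^-1 = (1 - weight_share tau (val nu)) / tau i (val sg).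
  by rewrite /kappa /weight_drop invf_div.
pose X : set 'rV[int]_(d + m).+1 := @flip _ @^-1` exponent_set kappa (drop_prime (val nu)) w.
have finX' : finite_set X by apply: finite_preimage finX => b b' _ _; exact: (can_inj (@flipK _)).
pose A : R := (val (val nu))%:R ^+ (C + s + N).
pose q i (sg : T) : R := ((val (val sg))%:R ^+ (s + N)) `^ (kappa i (val sg))^-1.
have A0 : 0 < A by rewrite exprn_gt0// padic_pos.
(* The power of [H] in the last clause is positive by the choice of [w]; it absorbs the constants
   [q] and [A]. *)
have large : \forall H \near \oo, [/\ (0 < H)%N,
    forall (sg : S) i, (s + N <= elev i (val sg) H)%N,
    forall b, sol H b -> forall (nu : S) i, lev (elev i (val nu) H - (s + N)) (approx y b nu i),
    forall b, sol H b -> b ord0 ord0 != 0 &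
    forall (sg : T) i, q i sg * A `^ w <
      H%:R `^ (1 - weight_share tau (val nu) - w * (1 - tau i0 (val nu)))].
  near=> H; split.
  - by near: H; exact: nbhs_infty_ge.
  - by near: H; exact: elev_large_all.
  - by near: H; exact: sol_approx.
  - by near: H; exact: sol_b0.
  - near: H; apply: filter_forall => sg; apply: filter_forall => i.
    by apply: powR_large; rewrite subr_gt0.
have [H1 _ hH1] := large.
apply: (@infinite_approx T _ (drop_prime (val nu)) X (fun i sg H => elev i (val sg) H - (s + N))%N _ _ _ finX').
- move=> i sg K; near=> H; rewrite leq_subRL.
    by near: H; apply: elev_large.
  by near: H; apply: elev_large.
- move=> b b0 ex; apply: exponent_set_flip => i sg; rewrite /approx ex.
  have -> : padic_abs R (0 : padic (val sg)) = 0 by apply/eqP; rewrite padic_abs_eq0.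
  rewrite powR0 ?powR_ge0// kappaE mulf_neq0 ?gt_eqF// invr_gt0 tau_gt0//.
move=> H0; have [H HH nHb] := nH (maxn H0 H1).
move: HH; rewrite geq_max => /andP[H0H H1H].
have [Hgt0 sNe happ hb0 hq] := hH1 H H1H.
have [b [hb [j [hj jlt]]]] : exists b, sol H b /\ exists j, lev j ((b ord0 ord0)%:~R : padic (val nu)) /\
    (elev i0 (val nu) H < j + C)%N.
  apply: contrapT => nex; apply: nHb => b hb j hj; rewrite leqNgt; apply/negP => jlt.
  by apply: nex; exists b; split=> //; exists j.
(* With this [g], the power [p^g] divides every entry of [b]: it divides [b_0] as [g <= j], and then
   [b_i = y_i b_0 - (b_0 y_i - b_i)], because every approximation at [nu] has level at least [g]. *)
set p := val (val nu); set g := (elev i0 (val nu) H - (C + s + N))%N.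
have gj : (g <= j)%N.
  rewrite /g leq_subLR (leq_trans (ltnW jlt))//.
  rewrite (_ : (C + s + N + j = j + C + (s + N))%N) ?leq_addr//; by ring.
have bl k : lev g ((b ord0 k)%:~R : padic (val nu)).
  have lev0 : lev g ((b ord0 ord0)%:~R : padic (val nu)) by exact: lev_le hj.
  have [->//|] := eqVneq k ord0; rewrite eq_sym => /unlift_some[i -> _].
  have -> : (b ord0 (lift ord0 i))%:~R =
      y nu 0 i * (b ord0 ord0)%:~R - approx y b nu i :> padic (val nu).
    by rewrite /approx; ring.
  apply: levB; first by apply: levMr => //; exact: y_int.
  apply: lev_le (happ b hb nu i); rewrite /g leq_sub//; first by apply: elev_mono.
  by rewrite -addnA leq_addl.
pose b' : 'rV[int]_(d + m).+1 := \row_k (b ord0 k %/ (p ^ g)%N%:Z)%Z.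
have bE : b = (p ^ g)%N%:Z *: b'.
  by apply/rowP => k; rewrite !mxE mulrC divzK// -lev_int; exact: bl.
have b'0 : b' != 0.
  by have [b0 _ _ _] := hb; apply: contra b0 => /eqP b'0; rewrite bE b'0 scaler0.
(* At the other primes [p^g] is a unit, so [b'] approximates as well as [b], although its height is
   only of order [H^(1 - tau)]. *)
have hl i (sg : T) : lev (elev i (val sg) H - (s + N)) (approx (drop_prime (val nu)) b' sg i).
  have := happ b hb (fincl (fsubD1set S (val nu)) sg) i; rewrite bE approxZ.
  rewrite -[X in lev X _ -> _]add0n lev_intM ?lev_int0//.
  rewrite lev_int expn1 dvdzE !absz_nat (Euclid_dvdX _ _ (valP (val sg))).
  by rewrite dvdn_prime2 ?(valP (val sg)) ?(valP (val nu))// val_eqE (negPf (TSn sg)).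
exists H, b'; split=> //; apply: exponent_set_flip => i sg.
have Hgt0R : 0 < H%:R :> R by rewrite ltr0n.
have Hn0 (t u : R) : (t + u == 0) ==> ((H%:R : R) != 0) by rewrite [H%:R == 0]gt_eqF// implybT.
have pw (sg' : T) : 0 < (val (val sg'))%:R ^+ (s + N) :> R by rewrite exprn_gt0// padic_pos.
(* Raising to [1 / kappa = (1 - share) / tau] turns every weight into the same power of [H]. *)
apply: (@le_trans _ _ (q i sg * H%:R `^ (- (1 - weight_share tau (val nu))))).
  have hle : padic_abs R (approx (drop_prime (val nu)) b' sg i) <=
      (val (val sg))%:R ^+ (s + N) * H%:R `^ (- tau i (val sg)).
    have := hl i sg; rewrite (lev_abs R) => /le_trans; apply.
    rewrite powRN ler_pdivlMr ?powR_gt0// mulrC ler_pdivrMr ?exprn_gt0 ?padic_pos// -exprD.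
    by rewrite addnC subnK ?elev_ge//; exact: (sNe (fincl (fsubD1set S (val nu)) sg) i).
  have kap_ge0 : 0 <= (kappa i (val sg))^-1 by rewrite kappaE divr_ge0// ltW// tau_gt0.
  apply: (le_trans (ge0_ler_powR kap_ge0 _ _ hle)).
  - by rewrite nnegrE padic_abs_ge0.
  - by rewrite nnegrE mulr_ge0// ?powR_ge0// ltW.
  rewrite powRM ?powR_ge0// ?(ltW (pw _))// -powRrM kappaE mulNr mulrCA mulfV ?mulr1.
    by rewrite /q kappaE.
  by rewrite gt_eqF// tau_gt0.
have ph : ((p ^ g)%N * height b' <= H)%N.
  rewrite mulnC -leq_divRL ?expn_gt0 ?(ltn_trans _ (pint_p_gt1 _))//.
  apply/bigmax_leqP => k _; rewrite leq_divRL ?expn_gt0 ?(ltn_trans _ (pint_p_gt1 _))// mulnC.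
  by have [_ /(_ k) + _ _] := hb; rewrite bE mxE abszM absz_nat.
have hA : (height b')%:R <= A * H%:R `^ (1 - tau i0 (val nu)).
  rewrite powRD; last exact: Hn0.
  rewrite powRr1 ?ler0n// powRN mulrA ler_pdivlMr ?powR_gt0//.
  apply: (@le_trans _ _ ((height b')%:R * p%:R ^+ elev i0 (val nu) H)).
    by rewrite ler_wpM2l ?elev_ge.
  apply: (@le_trans _ _ ((height b')%:R * (p%:R ^+ g * A))).
    rewrite ler_wpM2l// -exprD ler_weXn2l ?ler1n ?(ltnW (pint_p_gt1 _))//.
    by rewrite addnC -leq_subLR.
  by rewrite mulrCA mulrA mulrC ler_wpM2l ?(ltW A0)// -natrX -natrM ler_nat.
have h0 : 0 < (height b')%:R :> R by rewrite ltr0n height_gt0.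
have hw : (height b')%:R `^ w <= A `^ w * H%:R `^ (w * (1 - tau i0 (val nu))).
  have := ge0_ler_powR w0 _ _ hA; rewrite !nnegrE ler0n mulr_ge0 ?powR_ge0 ?(ltW A0)//.
  by move=> /(_ isT isT) /le_trans; apply; rewrite powRM ?powR_ge0 ?(ltW A0)// -powRrM mulrC [w * _]mulrC mulrC.
rewrite [leRHS]powRN -[leRHS]mul1r ler_pdivlMr ?powR_gt0//.
have q0 : 0 <= q i sg * H%:R `^ (- (1 - weight_share tau (val nu))) by rewrite mulr_ge0 ?powR_ge0.
apply: (le_trans (ler_wpM2l q0 hw)).
rewrite mulrACA -powRD; last exact: Hn0.
apply: (le_trans (ler_wpM2r _ (ltW (hq sg i)))); first exact: powR_ge0.
rewrite -powRD; last exact: Hn0.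
by rewrite (_ : _ + _ = 0) ?powRr0//; ring.
Unshelve. all: by end_near. Qed.

End Point.
End Weights.

(** * Boxes of approximated points *)

Lemma level_arith (j s t e : nat) : (j + (s + t) <= e)%N ->
  [/\ (j + (e - s - j) = e - s)%N, (j + (e - s - j) + s = e)%N & (t <= e - s - j)%N].
Proof. by move=> h; split; lia. Qed.

Section Hits.
Variables (R : realType) (S : {fset prime_nat}) (d m : nat).
Variables (U : forall nu : prime_nat, set 'rV[padic nu]_d).
Variables (f : forall nu : prime_nat, 'rV[padic nu]_d -> 'rV[padic nu]_m).
Arguments U : clear implicits.
Arguments f : clear implicits.
Variables (tau : 'I_(d + m) -> prime_nat -> R).
Hypothesis S_neq0 : S != fset0.
Hypothesis d_gt0 : (0 < d)%N.
Hypothesis U_open : forall nu, nu \in S -> open (U nu).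
Hypothesis U_int : forall nu, nu \in S -> U nu `<=` padic_Zpow nu d.
Hypothesis f_int : forall nu, nu \in S -> forall x, U nu x -> padic_Zpow nu m (f nu x).
Hypothesis f_C2 : forall nu, nu \in S -> Ck 2 (U nu) (f nu).
Hypothesis tau_gt0 : forall i nu, nu \in S -> 0 < tau i nu.
Hypothesis tau_sum : \sum_(i < d + m) \sum_(nu <- S) tau i nu = (d + m).+1%:R.
Hypothesis tau_le : forall nu, nu \in S -> forall i j, tau (rshift d j) nu <= tau (lshift m i) nu.
Hypothesis tau_share : forall nu, nu \in S -> forall j, weight_share tau nu < tau j nu.

Let F : QT S d -> QT S (d + m) := @param S d m f.
Let dom : set (QT S d) := @prodU S d U.

Lemma padic_Zpow_lev p k (x : 'rV[padic p]_k) : padic_Zpow p k x <-> forall i, lev 0 (x 0 i).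
Proof. by split=> h i; have := h i; rewrite /lev expr0 invr1. Qed.

Lemma dom_int x : dom x -> forall (nu : S) i, lev 0 (x nu 0 i).
Proof. by move=> Ux nu; apply/padic_Zpow_lev; apply: U_int (valP nu) _ (Ux nu). Qed.

Lemma f_lev x : dom x -> forall (nu : S) j, lev 0 (f (val nu) (x nu) 0 j).
Proof. by move=> Ux nu; apply/padic_Zpow_lev; apply: f_int (valP nu) _ (Ux nu). Qed.

Lemma dom_box x : dom x -> exists r, box (fun=> r) x `<=` dom.
Proof.
move=> Ux; have /choice[r rP] (nu : S) : exists r, forall y : 'rV[padic (val nu)]_d,
    (forall i, lev r (y 0 i - x nu 0 i)) -> U (val nu) y.
  by apply/nbhs_padic_row; apply: open_nbhs_nbhs; split; [exact: U_open (valP nu)|exact: Ux].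
exists (\max_nu r nu)%N => y xy nu; apply: rP => i.
by apply: lev_le (xy (nu, i)); exact: leq_bigmax.
Qed.

Lemma dom_open : open dom.
Proof. by rewrite openE => x /dom_box[r rP]; apply/nbhs_box; exists r. Qed.

Lemma preimage_param_open (B : set (QT S (d + m))) : open B -> open (dom `&` F @^-1` B).
Proof.
move=> oB; rewrite openE => x [Ux Bx]; apply/nbhs_box.
have [r rP] := dom_box Ux.
have /nbhs_box[k kB] : nbhs (F x) B by exact: open_nbhs_nbhs.
have /choice[t tP] (nu : S) : exists t, forall y : 'rV[padic (val nu)]_d, U (val nu) y ->
    (forall i, lev t (y 0 i - x nu 0 i)) -> forall j, lev k (f (val nu) y 0 j - f (val nu) (x nu) 0 j).
  have [cf _] := f_C2 (valP nu).
  by have [t] := within_continuous_row k cf (Ux nu); exists t.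
exists (maxn r (maxn k (\max_nu t nu)))%N => y xy.
have Uy : dom y by apply: rP; apply: box_le xy => c; exact: leq_maxl.
split=> //; apply: kB => -[nu i]; rewrite /F /param /= !mxE.
case: splitP => j _.
  by apply: lev_le (xy (nu, j)); rewrite leq_max (leq_maxl k) orbT.
apply: tP; first exact: Uy.
move=> l; apply: lev_le (xy (nu, l)).
by rewrite leq_max (leq_trans _ (leq_maxr k _)) ?orbT// leq_bigmax.
Qed.

(** Precision is tied to the bound [H] and not to the height of [b], so for fixed [H] this is a
    union of boxes of fixed levels. As [height b <= H], it is at least what [W] demands. *)
Definition hit kap H : set (QT S (d + m)) := [set y | exists b : 'rV[int]_(d + m).+1,
  [/\ b != 0, forall j, (`|b ord0 j| <= H)%N &
    forall (nu : S) i, lev (elev tau kap i (val nu) H) (approx y b nu i)]].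

Lemma hit_open kap H : open (hit kap H).
Proof.
apply: (@invariant_open _ _ (fun c => elev tau kap c.2 (val c.1) H)) => y [b [b0 bH hb]] z yz.
exists b; split=> // nu i.
have -> : approx z b nu i = approx y b nu i + (b ord0 ord0)%:~R * (z nu 0 i - y nu 0 i).
  by rewrite /approx; ring.
apply: levD; first exact: hb.
by apply: levMr; [exact: lev_int0|exact: (yz (nu, i))].
Qed.

Definition unhit kap H0 : set (QT S d) := dom `\` \bigcup_(H in [set H | (H0 <= H)%N]) F @^-1` hit kap H.

Lemma unhit_measurable kap H0 : measurable (unhit kap H0 : set (borelQT S d)).
Proof.
have -> : unhit kap H0 = dom `\` \bigcup_(H in [set H | (H0 <= H)%N]) (dom `&` F @^-1` hit kap H).
  apply/seteqP; split=> x [Ux nx]; split=> // -[H HH]; first by move=> [_ h]; apply: nx; exists H.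
  by move=> h; apply: nx; exists H.
apply: measurableD; first exact: open_measurable_QT dom_open.
apply: open_measurable_QT; apply: bigcup_open => H _.
by apply: preimage_param_open; exact: hit_open.
Qed.

Section Point.
Variables (kap : nat) (x : QT S d).
Hypothesis kap_gt0 : (0 < kap)%N.
Hypothesis Ux : dom x.
Hypothesis exponent_small : forall nu, nu \in S -> forall i,
  (forall j, tau i nu <= tau j nu) -> tau i nu <= 1 ->
  exists w, [/\ 0 <= w, w * (1 - tau i nu) < 1 - weight_share tau nu &
    finite_set (exponent_set (weight_drop tau nu) (restr (fsubD1set S nu) (F x)) w)].

(** The point [z] has coordinates [b_i / b_0], and the levels of its box with [x] are those of [sol]
    minus the order of [b_0]. Going [s] levels deeper around [z] recovers full precision; [N]
    further levels pay for the denominators of [D]. *)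
Lemma box_hit : exists q, forall H0 N0, exists H a z, [/\ (H0 <= H)%N, forall c, (N0 <= a c)%N,
  box a x z & box (fun c => (a c + q)%N) z `<=` F @^-1` hit kap H].
Proof.
have diff (nu : S) := Ck_differentiable (U_open (valP nu)) (Ux nu) (f_C2 (valP nu)).
pose D (nu : S) := projT1 (cid (diff nu)).
have DP (nu : S) := projT2 (cid (diff nu)); rewrite -/(D _) in DP.
have [N NP] : exists N, forall (nu : S) i j, lev 0 ((val (val nu) ^ N)%N%:R * D nu i j).
  have /choice[M MP] (c : S * ('I_d * 'I_m)) : exists N,
      lev 0 ((val (val c.1) ^ N)%N%:R * D c.1 c.2.1 c.2.2) by exact: lev_bounded.
  exists (\max_c M c)%N => nu i j; set K := (\max_c M c)%N.
  have MK : (M (nu, (i, j)) <= K)%N by exact: leq_bigmax.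
  rewrite -(subnK MK) expnD natrM -mulrA; apply: levMr; first exact: lev_nat0.
  exact: (MP (nu, (i, j))).
pose s := ((d + m) * (1 + kap) + m * N)%N.
(* A remainder [s] levels finer than the displacement makes up exactly for the [s] levels missing in
   the box around [x]. *)
have [r rP] : exists r, forall (nu : S) (y : 'rV[padic (val nu)]_d) rho, (r <= rho)%N ->
    (forall i, lev rho (y 0 i - x nu 0 i)) -> forall j,
    lev (rho + s) ((f (val nu) y - f (val nu) (x nu) - (y - x nu) *m D nu) 0 j).
  have /choice[r rP] (nu : S) := DP nu s.
  exists (\max_nu r nu)%N => nu y rho rrho; apply: rP; apply: leq_trans rrho.
  exact: leq_bigmax.
exists (s + N)%N => H0 N0.
have [r0 r0P] := dom_box Ux.
pose fx : QT S m := fun nu => f (val nu) (x nu).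
near \oo => H.
have HH0 : (H0 <= H)%N by near: H; exact: nbhs_infty_ge.
have Hgt0 : (0 < H)%N by near: H; exact: nbhs_infty_ge.
have [b hb] : exists b, sol tau kap x fx D N H b.
  by near: H; apply: sol_ex => //; [exact: dom_int|exact: f_lev].
have b0n : b ord0 ord0 != 0.
  by move: b hb; near: H; exact: sol_b0.
(* The margin beyond [s] keeps the levels of the box above [N0] and above the radius [r] at which
   the remainder is controlled. *)
have val_le : forall (nu : S) i j, lev j ((b ord0 ord0)%:~R : padic (val nu)) ->
    (j + (s + (N0 + r + r0)) <= elev tau kap i (val nu) H)%N.
  by move: b hb {b0n}; near: H; apply: sol_valuation => //; [exact: dom_int|exact: f_lev].
have /choice[j jP] (nu : S) : exists j, lev j ((b ord0 ord0)%:~R : padic (val nu)) /\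
    ~~ lev j.+1 ((b ord0 ord0)%:~R : padic (val nu)).
  by have [j [h1 h2 _]] := lev_valuation (val nu) b0n; exists j.
have je (nu : S) i : (j nu + (s + (N0 + r + r0)) <= elev tau kap i (val nu) H)%N.
  by apply: val_le; have [] := jP nu.
have [b0 bH hbx hbt] := hb.
pose a (c : S * 'I_d) := (elev tau kap (lshift m c.2) (val c.1) H - s - j c.1)%N.
have aE nu i : (j nu + a (nu, i) = elev tau kap (lshift m i) (val nu) H - s)%N.
  by have [] := level_arith (je nu (lshift m i)).
have ae nu i : (j nu + a (nu, i) + s = elev tau kap (lshift m i) (val nu) H)%N.
  by have [] := level_arith (je nu (lshift m i)).
have a_ge nu i : (N0 + r + r0 <= a (nu, i))%N.
  by have [] := level_arith (je nu (lshift m i)).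
pose z : QT S d := fun nu => \row_i ((b ord0 (lift ord0 (lshift m i)))%:~R / (b ord0 ord0)%:~R).
have bnz (nu : S) : ((b ord0 ord0)%:~R : padic (val nu)) != 0.
  by apply/negP => /eqP e; have [_] := jP nu; rewrite e lev_zero.
have bz (y : QT S d) nu i : (b ord0 ord0)%:~R * (y nu 0 i - z nu 0 i) = approx (F y) b nu (lshift m i).
  by rewrite /z /approx /F /param row_mxEl mxE mulrBr mulrCA (mulfV (bnz nu)) mulr1.
have xz : box a x z.
  move=> [nu i] /=; have [h1 h2] := jP nu.
  by rewrite lev_distC -(lev_intM _ _ h1 h2) bz aE; exact: hbx.
exists H, a, z; split=> // [[nu i]|y zy].
  by apply: leq_trans (a_ge nu i); rewrite -addnA leq_addr.
have xy : box a x y.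
  by apply: box_trans xz _; apply: box_le zy => c; exact: leq_addr.
have hx nu i : lev (elev tau kap (lshift m i) (val nu) H + N) (approx (F y) b nu (lshift m i)).
  have [h1 h2] := jP nu; rewrite -bz -ae.
  rewrite (_ : (j nu + a (nu, i) + s + N = j nu + (a (nu, i) + (s + N)))%N); last by ring.
  by rewrite (lev_intM _ _ h1 h2); exact: (zy (nu, i)).
exists b; split=> // nu i'; rewrite -(splitK i'); case: (fintype.split i') => i /=.
  by apply: lev_le (hx nu i); exact: leq_addr.
(* Expanding at [x] leaves the tangent form, fine by the choice of [b]; linear terms in the
   independent forms at [y], fine near [z]; and [b_0] times the remainder, where the order of [b_0]
   restores what the box lost in the division by [b_0]. *)
have -> : approx (F y) b nu (rshift d i) = tangent_form x fx D b nu i +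
    \sum_l approx (F y) b nu (lshift m l) * D nu l i +
    (b ord0 ord0)%:~R * (f (val nu) (y nu) - f (val nu) (x nu) - (y nu - x nu) *m D nu) 0 i.
  have -> : ((f (val nu) (y nu) - f (val nu) (x nu) - (y nu - x nu) *m D nu) 0 i) =
      f (val nu) (y nu) 0 i - f (val nu) (x nu) 0 i - \sum_l (y nu 0 l - x nu 0 l) * D nu l i.
    by rewrite !mxE; congr (_ - _); apply: eq_bigr => l _; rewrite !mxE.
  rewrite /tangent_form /approx /F /param /fx !row_mxEr.
  rewrite [X in _ = _ + _ + X]mulrBr mulr_sumr.
  under [X in _ = _ - X + _ + _]eq_bigr do rewrite row_mxEl.
  under [X in _ = _ + X + _]eq_bigr do rewrite row_mxEl.
  rewrite (_ : \sum_l ((b ord0 ord0)%:~R * y nu 0 l - (b ord0 (lift ord0 (lshift m l)))%:~R) * D nu l i =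
    \sum_l ((b ord0 ord0)%:~R * x nu 0 l - (b ord0 (lift ord0 (lshift m l)))%:~R) * D nu l i +
    \sum_l (b ord0 ord0)%:~R * ((y nu 0 l - x nu 0 l) * D nu l i)); first by ring.
  by rewrite -big_split; apply: eq_bigr => l _ /=; ring.
apply: levD; first apply: levD; first exact: hbt.
  apply: lev_sum => l _; apply: (@lev_le _ _ (elev tau kap (lshift m l) (val nu) H + N - N)).
    by rewrite addnK elev_mono// tau_le// (valP nu).
  by apply: levM_bounded; [exact: leq_addl|exact: hx|exact: NP].
pose rho := (elev tau kap (rshift d i) (val nu) H - s - j nu)%N.
have [_ rhoE rho_ge] := level_arith (je nu (rshift d i)).
rewrite -/rho -addnA in rhoE rho_ge.
rewrite -rhoE; apply: levM; first by have [] := jP nu.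
apply: rP.
  by apply: leq_trans rho_ge; rewrite addnAC leq_addl.
move=> l; apply: lev_le (xy (nu, l)).
by rewrite !leq_sub2r// elev_mono// tau_le// (valP nu).
Unshelve. all: by end_near. Qed.

End Point.
End Hits.

(** * Measurability *)

(** Turns the infinitude in [W] into a countable intersection of countable unions of open
    conditions, for measurability. *)
Lemma infinite_countP (X : countType) (A : set X) :
  infinite_set A <-> forall N, exists2 x, A x & (N <= choice.pickle x)%N.
Proof.
split=> [infA N|h /finite_fsetP[B AB]].
  apply: contrapT => h; apply: infA.
  apply: (@sub_finite_set _ _ (choice.pickle @^-1` `I_N)); last first.
    apply: finite_preimage (finite_II N) => x y _ _; exact: (pcan_inj choice.pickleK).
  by move=> x Ax /=; rewrite ltnNge; apply/negP => Nx; apply: h; exists x.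
have [x Ax] := h (\max_(b : B) choice.pickle (val b)).+1.
have xB : x \in B by move: Ax; rewrite AB.
by rewrite leqNgt ltnS (@leq_bigmax _ (fun b : B => choice.pickle (val b)) [` xB]%fset).
Qed.

Section WeightedSets.
Variables (R : realType) (T : {fset prime_nat}) (n : nat).

Lemma approx_open (b : 'rV[int]_n.+1) (rho : 'I_n -> T -> R) :
  open [set y : QT T n | forall i (nu : T), padic_abs R (approx y b nu i) < rho i nu].
Proof.
rewrite openE => y hy; apply/nbhs_box.
have /choice[k kP] (c : T * 'I_n) : exists k, (val (val c.1))%:R ^- k < rho c.2 c.1.
  apply: natinv_lt; first exact: pint_p_gt1.
  by apply: le_lt_trans (hy c.2 c.1); exact: padic_abs_ge0.
exists (\max_c k c)%N => z yz i nu.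
have -> : approx z b nu i = approx y b nu i + (b ord0 ord0)%:~R * (z nu 0 i - y nu 0 i).
  by rewrite /approx; ring.
apply: le_lt_trans (padic_absD _ _ _) _; rewrite gt_max hy /=.
apply: le_lt_trans (kP (nu, i)); rewrite -lev_abs.
apply: levMr; first exact: lev_int0.
by apply: lev_le (yz (nu, i)); exact: leq_bigmax.
Qed.

End WeightedSets.

Lemma weight_minE (R : realType) k (a : 'I_k -> R) i : (forall j, a i <= a j) ->
  weight_min a = (a i)%:E.
Proof.
move=> h; apply/eqP; rewrite eq_le /weight_min bigmin_le/=.
by apply: le_bigmin => [|j _]; rewrite ?leey// lee_fin.
Qed.

Lemma ball_diff_measure (R : realType) (T : {fset prime_nat}) d
    (mu : {measure set (borelQT T d) -> \bar R})
    (mu_translate : forall (A : set (borelQT T d)) (u : QT T d), measurable A -> mu (translate u @` A) = mu A)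
    (mu_unit : mu (box (fun=> 0%N) (fun=> 0)) = 1%E)
    (A : set (borelQT T d)) (a : T * 'I_d -> nat) q (x z : QT T d) : measurable A ->
  box a x z -> A `&` box (fun c => (a c + q)%N) z = set0 ->
  (mu (A `&` box a x) <= ((1 - @vol R T d (fun=> q)) * vol R a)%:E)%E.
Proof.
move=> mA xz Az; set b := fun c => (a c + q)%N.
have mb := box_measurable b z; have ma := box_measurable a x.
have ba : box b z `<=` box a x.
  by rewrite -(box_eq xz); apply: box_le => c; exact: leq_addr.
have volb : vol R b = @vol R T d (fun=> q) * vol R a.
  by rewrite /vol -big_split /=; apply: eq_bigr => c _; rewrite exprD invfM mulrC.
have e : mu (box a x) = (mu (box a x `\` box b z) + mu (box a x `&` box b z))%E by exact: measureDI.
apply: (@le_trans _ _ (mu (box a x `\` box b z))).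
  apply: le_measure; rewrite ?inE; [exact: measurableI|exact: measurableD|].
  by move=> y [Ay xy]; split=> // zy; rewrite -[False]/(set0 y) -Az.
move: e; rewrite (setIidr ba) !(mu_box mu_translate mu_unit) volb => e.
have fD : mu (box a x `\` box b z) \is a fin_num.
  rewrite ge0_fin_numE//; apply: (@le_lt_trans _ _ (mu (box a x))).
    by apply: le_measure; rewrite ?inE//; exact: measurableD.
  by rewrite (mu_box mu_translate mu_unit) ltry.
by move: e; rewrite -(fineK fD) -EFinD lee_fin => -[e]; rewrite mulrBl mul1r lerBrDr -e.
Qed.

(** * Proof of the theorem *)

(** For [t = 1] the extended quotient is [+oo] and any [w] meets the last bound; otherwise take the
    midpoint of [max w0 0] and the quotient. Nonnegativity makes [w]-th powers of heights
    monotone. *)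
Lemma ex_weight (R : realType) (w0 sh t : R) : t <= 1 -> sh < 1 ->
  (w0%:E < (1 - sh)%:E / (1 - t%:E))%E ->
  exists w, [/\ 0 <= w, w0 < w & w * (1 - t) < 1 - sh].
Proof.
move=> t1 sh1 h; have [te|tne] := eqVneq t 1.
  exists (Num.max w0 0 + 1); rewrite te subrr mulr0 subr_gt0; split=> //.
    by rewrite addr_ge0// le_max lexx orbT.
  by rewrite ltr_pwDr// le_max lexx.
have t0 : 0 < 1 - t by rewrite subr_gt0 lt_neqAle tne.
have {}h : w0 < (1 - sh) / (1 - t).
  by move: h; rewrite -EFinB inver gt_eqF// -EFinM lte_fin.
have B0 : 0 < (1 - sh) / (1 - t) by rewrite divr_gt0// subr_gt0.
have mlt : Num.max w0 0 < (1 - sh) / (1 - t) by rewrite gt_max h.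
exists ((Num.max w0 0 + (1 - sh) / (1 - t)) / 2); split.
- by rewrite divr_ge0// addr_ge0 ?(ltW B0)// le_max lexx orbT.
- by apply: (@le_lt_trans _ _ (Num.max w0 0)); [rewrite le_max lexx|exact: (midf_lt mlt).1].
- by rewrite -ltr_pdivlMr//; have [_] := midf_lt mlt.
Qed.

Lemma exponent_finite (R : realType) (T : {fset prime_nat}) n (kappa : 'I_n -> prime_nat -> R)
    (y : QT T n) (w0 w : R) : (exponent kappa y <= w0%:E)%E -> w0 < w ->
  finite_set (exponent_set kappa y w).
Proof.
move=> h w0w; apply: contrapT => inf; move: w0w; apply/negP; rewrite -leNgt -lee_fin.
apply: le_trans h; apply: ereal_sup_ubound; exists w => //; exact: inf.
Qed.

Theorem theorem8p10 (R : realType)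
  (mu : forall (T : {fset prime_nat}) (k : nat),
    {measure set (borelQT T k) -> \bar R})
  (mu_haar : forall T k, is_normalized_haar (mu T k))
  (S : {fset prime_nat}) (S_neq0 : S != fset0)
  (d m : nat) (d_gt0 : (0 < d)%N) (m_gt0 : (0 < m)%N)
  (U : forall nu : prime_nat, set 'rV[padic nu]_d)
  (f : forall nu : prime_nat, 'rV[padic nu]_d -> 'rV[padic nu]_m)
  (U_open : forall nu, nu \in S -> open (U nu))
  (U_int : forall nu, nu \in S -> U nu `<=` padic_Zpow nu d)
  (f_int : forall nu, nu \in S -> forall x, U nu x -> padic_Zpow nu m (f nu x))
  (f_C2 : forall nu, nu \in S -> Ck 2 (U nu) (f nu))
  (tau : 'I_(d + m) -> prime_nat -> R)
  (tau_gt0 : forall i nu, nu \in S -> 0 < tau i nu)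
  (tau_sum : \sum_(i < d + m) \sum_(nu <- S) tau i nu = (d + m).+1%:R)
  (tau_order : forall nu, nu \in S ->
    (weight_max (fun j : 'I_m => tau (rshift d j) nu)
      <= weight_min (fun i : 'I_d => tau (lshift m i) nu))%E)
  (tau_share : forall nu, nu \in S ->
    forall j, weight_share tau nu < tau j nu)
  (exponent_lt : forall nu, nu \in S ->
    (weight_min (tau^~ nu) <= 1)%E ->
    (manifold_exponent U f (mu (S `\ nu)%fset d) (weight_drop tau nu)
      < (1 - weight_share tau nu)%:E / (1 - weight_min (tau^~ nu)))%E) :
  mu S d (prodU U `&` param f @^-1` Bad tau) = 0%E.
Proof.
have haar_translate T k (A : set (borelQT T k)) (u : QT T k) :
    measurable A -> mu T k (translate u @` A) = mu T k A.
  by move=> mA; exact: (mu_haar T k).1.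
have ZTE T k : ZT T k = box (fun=> 0%N) (fun=> 0).
  apply/seteqP; split=> x h; last first.
    by move=> nu; apply/padic_Zpow_lev => i; have := h (nu, i); rewrite /= mxE subr0.
  by move=> [nu i] /=; rewrite mxE subr0; apply/padic_Zpow_lev: i; exact: h.
have haar_unit T k : mu T k (box (fun=> 0%N) (fun=> 0)) = 1%E.
  by rewrite -ZTE; exact: (mu_haar T k).2.
have tau_le nu : nu \in S -> forall i j, tau (rshift d j) nu <= tau (lshift m i) nu.
  move=> nuS i j; rewrite -lee_fin.
  apply: (@le_trans _ _ (weight_max (fun j => tau (rshift d j) nu))).
    exact: (@le_bigmax _ _ _ -oo%E (fun j => (tau (rshift d j) nu)%:E) j).
  by apply: (le_trans (tau_order nu nuS)); exact: (@bigmin_le _ _ _ +oo%E i (fun i => (tau (lshift m i) nu)%:E)).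
have dom_unit : prodU U `<=` box (fun=> 0%N) ((fun=> 0) : QT S d).
  by rewrite -ZTE => x Ux nu; apply: U_int (valP nu) _ (Ux nu).
have F_unit x : prodU U x -> ZT S (d + m) (param f x).
  move=> Ux nu; apply/padic_Zpow_lev => i; rewrite /param mxE.
  by case: splitP => j _; [exact: (dom_int U_int Ux)|exact: (f_lev f_int Ux)].
pose Wb (c : R) (b : 'rV[int]_(d + m).+1) : set (QT S (d + m)) :=
  [set y | forall i (nu : S), padic_abs R (approx y b nu i) < c * (height b)%:R `^ (- tau i (val nu))].
have mW c : measurable (prodU U `&` param f @^-1` W c tau : set (borelQT S d)).
  have -> : prodU U `&` param f @^-1` W c tau =
      \bigcap_N \bigcup_(b in [set b | (N <= choice.pickle b)%N]) (prodU U `&` param f @^-1` Wb c b).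
    apply/seteqP; split=> x.
      move=> [Ux [_ /infinite_countP h]] N _; have [b hb Nb] := h N.
      by exists b.
    move=> h; have Ux : prodU U x by have [b _ []] := h 0%N I.
    split=> //; split; first exact: F_unit.
    by apply/infinite_countP => N; have [b Nb [_ hb]] := h N I; exists b.
  apply: bigcapT_measurable => N; apply: open_measurable_QT; apply: bigcup_open => b _.
  by apply: (preimage_param_open U_open f_C2); exact: approx_open.
have mBad : measurable (prodU U `&` param f @^-1` Bad tau : set (borelQT S d)).
  have -> : (prodU U `&` param f @^-1` Bad tau : set (QT S d)) = (prodU U `&` param f @^-1` W 1 tau) `\`
      \bigcap_(k : nat) (prodU U `&` param f @^-1` W (k.+1%:R^-1) tau).
    apply/seteqP; split=> x; first by move=> [Ux [W1 nW]]; split=> // h; apply: nW => k _; case: (h k I).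
    move=> [[Ux W1] nW]; split=> //; split=> // h; apply: nW => k _; split=> //; exact: h.
  by apply: measurableD => //; apply: bigcapT_measurable => k.
have arg_min_tau nu : exists i0 : 'I_(d + m), forall i, tau i0 nu <= tau i nu.
  have [i0 _ i0P] := @arg_minP _ _ _ (lshift m (Ordinal d_gt0)) xpredT (fun i => tau i nu) isT.
  by exists i0 => i; exact: i0P.
pose good (nu : prime_nat) (x : QT S d) := forall i,
  (forall j, tau i nu <= tau j nu) -> tau i nu <= 1 ->
  exists w, [/\ 0 <= w, w * (1 - tau i nu) < 1 - weight_share tau nu &
    finite_set (exponent_set (weight_drop tau nu) (restr (fsubD1set S nu) (param f x)) w)].
(* The infimum defining the manifold exponent lies below the quotient, so some [w0] in its set does
   too; [restr_null] lifts the exceptional set of [w0] from the other primes to [S]. *)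
have good_ae (nu : S) : (mu S d).-negligible [set x | prodU U x /\ ~ good (val nu) x].
  have [i0 i0P] := arg_min_tau (val nu); have nuS := valP nu.
  have [t1|t1] := leP (tau i0 (val nu)) 1; last first.
    apply: (negligibleS _ (negligible_set0 _)) => x [_]; apply => i iP i1.
    by move: t1; rewrite ltNge (le_trans (i0P i) i1).
  have wm := weight_minE i0P.
  have := exponent_lt _ nuS; rewrite wm lee_fin => /(_ t1).
  move=> /ereal_inf_lt[_ [w0 h0 <-]] w0lt.
  have sh1 : weight_share tau (val nu) < 1 by apply: lt_le_trans (tau_share _ nuS i0) t1.
  have [w [wge0 w0w wlt]] := ex_weight t1 sh1 w0lt.
  apply: negligibleS (restr_null (fsubD1set S (val nu)) (haar_translate S d) (haar_unit S d)
    (haar_translate _ d) (haar_unit _ d) h0).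
  move=> x [Ux ng]; split; last exact: dom_unit.
  move=> h; apply: ng => i iP i1; exists w; split=> //.
    have -> : tau i (val nu) = tau i0 (val nu) by apply/eqP; rewrite eq_le iP i0P.
    exact: wlt.
  apply: exponent_finite w0w; apply: h => sg.
  exact: (Ux (fincl (fsubD1set S (val nu)) sg)).
have null_unhit kap H0 : (0 < kap)%N -> (mu S d).-negligible (unhit U f tau kap H0).
  move=> kap0; set E := unhit U f tau kap H0.
  have mE : measurable (E : set (borelQT S d)) by exact: unhit_measurable.
  have E_unit : E `<=` box (fun=> 0%N) ((fun=> 0) : QT S d).
    by move=> x [Ux _]; exact: dom_unit.
  (* The depth [q] from [box_hit] varies with the point, so density is used for every [q], with
     [eta] the proportion of a sub-box [q] levels deeper, and the countably many null sets are
     united. *)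
  have dens q := density (haar_translate S d) (haar_unit S d) mE E_unit (vol_gt0 R ((fun=> q) : S * 'I_d -> nat)).
  pose good_bad : set (borelQT S d) :=
    \big[setU/set0]_(nu : S) [set x | prodU U x /\ ~ good (val nu) x].
  have good_bad_null : (mu S d).-negligible good_bad.
    by apply: big_ind => //; [exact: negligible_set0|move=> A B; exact: negligibleU].
  apply: negligibleS (negligibleU good_bad_null (negligible_bigcup dens)).
  move=> x Ex; have [Ux nhit] := Ex.
  have [[nu ng]|ng] := pselect (exists nu : S, ~ good (val nu) x).
    by left; rewrite /good_bad -bigcup_seq; exists nu => //; rewrite /= mem_index_enum.
  right; have gx nu : nu \in S -> good nu x.
    by move=> nuS; apply: contrapT => h; apply: ng; exists [` nuS]%fset.
  have [q hq] := box_hit S_neq0 d_gt0 U_open U_int f_int f_C2 tau_gt0 tau_sum tau_le tau_share kap0 Ux gx.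
  exists q => //; split=> // N; have [H [a [z [HH aN xz sub]]]] := hq H0 N.
  exists a; split=> //; apply: (ball_diff_measure (haar_translate S d) (haar_unit S d) mE xz).
  rewrite -subset0 => y [[Uy ny] zy]; apply: ny; exists H => //; exact: sub.
apply/negligibleP => //.
have nullU k : (mu S d).-negligible (\bigcup_H0 unhit U f tau k.+1 H0).
  by apply: negligible_bigcup => H0; exact: null_unhit.
apply: negligibleS (negligible_bigcup nullU).
move=> x [Ux [_ nW]].
have [k nWk] : exists k : nat, ~ W (k.+1%:R^-1) tau (param f x).
  by apply: contrapT => h; apply: nW => k _; apply: contrapT => hk; apply: h; exists k.
(* A point in no [unhit] set is hit for arbitrarily large [H], which by [infinite_approx] yields
   infinitely many vectors and so membership in [W]. *)
exists k => //; apply: contrapT => h; apply: nWk; split; first exact: F_unit.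
apply: (@infinite_approx S _ (param f x) _ (fun i nu H => elev tau k.+1 i (val nu) H)).
- by move=> i nu C; apply: lvl_large => //; apply: tau_gt0; exact: (valP nu).
- move=> b b0 ex i nu; rewrite ex.
  have -> : padic_abs R (0 : padic (val nu)) = 0 by apply/eqP; rewrite padic_abs_eq0.
  by rewrite mulr_gt0 ?invr_gt0// powR_gt0// ltr0n height_gt0.
move=> H0; have : ~ unhit U f tau k.+1 H0 x by move=> hx; apply: h; exists H0.
move=> nu_hit; have [H [HH [b [b0 bH hb]]]] : exists H, (H0 <= H)%N /\ hit tau k.+1 H (param f x).
  by apply: contrapT => nh; apply: nu_hit; split=> // -[H HH hx]; apply: nh; exists H.
exists H, b; split=> // i nu; have := hb nu i; rewrite (lev_abs R) => /le_lt_trans; apply.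
have ht0 := height_gt0 b0.
have hH : (height b <= H)%N by apply/bigmax_leqP => j _; exact: bH.
have Hgt0 : (0 < H)%N by exact: leq_trans ht0 hH.
have t0 : 0 < tau i (val nu) by apply: tau_gt0; exact: (valP nu).
apply: (@lt_le_trans _ _ (k.+1%:R^-1 * H%:R `^ (- tau i (val nu)))).
  rewrite powRN -invfM ltf_pV2 ?posrE ?exprn_gt0 ?padic_pos ?mulr_gt0 ?powR_gt0 ?ltr0n//.
  exact: lvl_gt.
rewrite ler_wpM2l ?invr_ge0// !powRN lef_pV2 ?posrE ?powR_gt0 ?ltr0n//.
by rewrite ge0_ler_powR ?nnegrE ?ler_nat// ltW.
Qed.
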